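(* Let $\Omega\subset\mathbb{P}(\mathbb{R}^d)$ be a properly convex domain, $c:[0,\infty)\to\Omega$ a projective geodesic ray, $x_0\in\Omega$, $R>0$, and let $\{\gamma_n\}_{n\in\mathbb{N}}$ be a sequence in $\mathrm{Aut}(\Omega)$ that $R$-tracks $c$ with respect to $x_0$. If $c$ is $M$-Morse for a Morse gauge $M$, then $\{\gamma_n\}$ is strongly uniformly $k$-regular for both $k=1$ and $k=d-1$. Moreover, the constants $C,N$ in the definition of strong uniform regularity depend only on $M$, $R$ and the basepoint $x_0\in\Omega$ (for the given domain $\Omega$).
   Context: A properly convex domain $\Omega\subset\mathbb{P}(\mathbb{R}^d)$ is a nonempty open convex set whose closure is a bounded convex subset of some affine chart. $\mathrm{Aut}(\Omega)\subset\mathrm{PGL}(d,\mathbb{R})$ is the group of projective transformations preserving $\Omega$. The Hilbert metric is $d_\Omega(x,y)=\frac12\log\frac{|a-y||b-x|}{|a-x||b-y|}$, where $a,b\in\partial\Omega$ are the points where the projective line through $x,y$ meets $\partial\Omega$, ordered $a,x,y,b$ along the line. A projective geodesic ray is a unit-speed (for $d_\Omega$) geodesic ray $c:[0,\infty)\to\Omega$ whose image is a projective line segment $[x,y)$ with $x\in\Omega$, $y\in\partial\Omega$. Morse: let $M:\mathbb{R}_{\ge0}\times\mathbb{R}_{\ge0}\to\mathbb{R}_{\ge0}$ be any function (a Morse gauge). A geodesic $\ell$ in a proper geodesic metric space is $M$-Morse if every $(\lambda,a)$-quasi-geodesic with endpoints on $\ell$ lies in the $M(\lambda,a)$-neighborhood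 of $\ell$. Tracking: $\{\gamma_n\}$ $R$-tracks $c$ with respect to $x_0$ if $d_\Omega(x_0,\gamma_n^{-1}c(n))<R$ for all $n\in\mathbb{N}$. Singular values: for $g\in\mathrm{GL}(d,\mathbb{R})$ let $\sigma_1(g)\ge\dots\ge\sigma_d(g)$ be its singular values and $\mu_{i,j}(g)=\log\frac{\sigma_i(g)}{\sigma_j(g)}$; this is well defined on $\mathrm{PGL}(d,\mathbb{R})$. For $1\le k<d$, a sequence $\{g_n\}$ is strongly uniformly $k$-regular if it is divergent (leaves every compact set of the group) and there are constants $C,N>0$ such that for all $n,m\in\mathbb{N}$ with $m>N$, $\frac{\mu_{k,k+1}(g_n^{-1}g_{n+m})}{\mu_{1,d}(g_n^{-1}g_{n+m})}>C$. *)

(* Defs.v *)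
From HB Require Import structures.
From mathcomp Require Import all_boot all_order all_algebra.
From mathcomp Require Import all_classical all_reals all_analysis.
Import Order.TTheory GRing.Theory Num.Theory.
Import numFieldNormedType.Exports.

Set Implicit Arguments.
Unset Strict Implicit.
Unset Printing Implicit Defensive.

Local Open Scope classical_set_scope.
Local Open Scope ring_scope.
Local Open Scope quotient_scope.

Definition boundary (T : topologicalType) (A : set T) : set T :=
  closure A `\` A^°.

(** Projective space, as a topological quotient of [R^d \ {0}]. *)
Section ProjectiveSpace.
Variables (R : realType) (d : nat).

Definition nzvec := set_type [set v : 'cV[R]_d | v != 0].
HB.instance Definition _ := SubType.on nzvec.
HB.instance Definition _ := Choice.on nzvec.
HB.instance Definition _ := Topological.on nzvec.

Lemma nzvecP (v : nzvec) : val v != 0.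
Proof. by have := valP v; rewrite inE. Qed.

Definition nzvec_of (v : 'cV[R]_d) (v0 : v != 0) : nzvec :=
  exist _ v (mem_set (v0 : [set v : 'cV[R]_d | v != 0] v)).

Definition proj_eq (v w : nzvec) : bool :=
  `[< exists2 c : R, c != 0 & val v = c *: val w >].

Lemma proj_eq_refl : reflexive proj_eq.
Proof. by move=> v; apply/asboolP; exists 1; rewrite ?oner_eq0 ?scale1r. Qed.

Lemma proj_eq_sym : symmetric proj_eq.
Proof.
suff H v w : proj_eq v w -> proj_eq w v by move=> v w; apply/idP/idP; exact: H.
move=> /asboolP[c c0 vw]; apply/asboolP; exists c^-1; first by rewrite invr_eq0.
by rewrite vw scalerA mulVf// scale1r.
Qed.

Lemma proj_eq_trans : transitive proj_eq.
Proof.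
move=> w v z /asboolP[c c0 vw] /asboolP[e e0 wz]; apply/asboolP.
by exists (c * e); rewrite ?mulf_neq0// vw wz scalerA.
Qed.

Canonical proj_eq_equiv :=
  EquivRel proj_eq proj_eq_refl proj_eq_sym proj_eq_trans.

Definition pspace := quotient_topology {eq_quot proj_eq}.
HB.instance Definition _ := Quotient.on pspace.
HB.instance Definition _ := Choice.on pspace.
HB.instance Definition _ := Topological.on pspace.

Definition hvec (p : pspace) : 'cV[R]_d := val (repr p).

(** A row vector [f], seen as a linear form, determines the affine chart
    [{[v] | f v != 0}], identified with the affine hyperplane [{v | f v = 1}]. *)
Definition chart (f : 'rV[R]_d) : set pspace :=
  [set p | (f *m hvec p) 0 0 != 0].

Definition chart_coord (f : 'rV[R]_d) (p : pspace) : 'cV[R]_d :=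
  ((f *m hvec p) 0 0)^-1 *: hvec p.

Lemma proj_piP (v w : nzvec) :
  \pi_pspace v = \pi_pspace w <-> exists2 c : R, c != 0 & val v = c *: val w.
Proof.
split=> e.
  by have /eqquotP/asboolP : v = w %[mod {eq_quot proj_eq}] by exact: e.
have /eqquotP ge : proj_eq v w by exact/asboolP.
exact: ge.
Qed.

Lemma hvec_pi (v : nzvec) :
  exists2 c : R, c != 0 & hvec (\pi_pspace v) = c *: val v.
Proof. by apply/proj_piP; rewrite reprK. Qed.

Lemma chart_coord_pi (f : 'rV[R]_d) (v : nzvec) :
  (f *m val v) 0 0 = 1 -> chart_coord f (\pi_pspace v) = val v.
Proof.
move=> fv; rewrite /chart_coord; have [c c0 ->] := hvec_pi v.
by rewrite -scalemxAr mxE fv mulr1 scalerA mulVf// scale1r.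
Qed.

End ProjectiveSpace.

(** [GL(d, R)] with the topology induced from matrices, and its quotient
    [PGL(d, R)] by nonzero scalars. *)
Section ProjectiveGroup.
Variables (R : realType) (d : nat).

Definition GL := set_type [set g : 'M[R]_d | g \in unitmx].
HB.instance Definition _ := SubType.on GL.
HB.instance Definition _ := Choice.on GL.
HB.instance Definition _ := Topological.on GL.

Lemma GLP (g : GL) : val g \in unitmx.
Proof. by have := valP g; rewrite inE. Qed.

Definition GL_of (g : 'M[R]_d) (gu : g \in unitmx) : GL :=
  exist _ g (mem_set (gu : [set g : 'M[R]_d | g \in unitmx] g)).

Fact GL_mul_subproof (g h : GL) : val g *m val h \in unitmx.
Proof. by rewrite unitmx_mul !GLP. Qed.

Fact GL_inv_subproof (g : GL) : invmx (val g) \in unitmx.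
Proof. by rewrite unitmx_inv GLP. Qed.

Definition GL_one : GL := GL_of (unitmx1 R d).
Definition GL_mul (g h : GL) : GL := GL_of (GL_mul_subproof g h).
Definition GL_inv (g : GL) : GL := GL_of (GL_inv_subproof g).

Fact GL_mulA : associative GL_mul.
Proof. by move=> g h k; apply/val_inj; rewrite /= mulmxA. Qed.

Fact GL_mul1g : left_id GL_one GL_mul.
Proof. by move=> g; apply/val_inj; rewrite /= mul1mx. Qed.

Fact GL_mulg1 : right_id GL_one GL_mul.
Proof. by move=> g; apply/val_inj; rewrite /= mulmx1. Qed.

Fact GL_mulVg : left_inverse GL_one GL_inv GL_mul.
Proof. by move=> g; apply/val_inj; rewrite /= mulVmx// GLP. Qed.

Fact GL_mulgV : right_inverse GL_one GL_inv GL_mul.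
Proof. by move=> g; apply/val_inj; rewrite /= mulmxV// GLP. Qed.

HB.instance Definition _ :=
  isGroup.Build GL GL_mulA GL_mul1g GL_mulg1 GL_mulVg GL_mulgV.

Definition pgl_eq (g h : GL) : bool :=
  `[< exists2 c : R, c != 0 & val g = c *: val h >].

Lemma pgl_eq_refl : reflexive pgl_eq.
Proof. by move=> v; apply/asboolP; exists 1; rewrite ?oner_eq0 ?scale1r. Qed.

Lemma pgl_eq_sym : symmetric pgl_eq.
Proof.
suff H v w : pgl_eq v w -> pgl_eq w v by move=> v w; apply/idP/idP; exact: H.
move=> /asboolP[c c0 vw]; apply/asboolP; exists c^-1; first by rewrite invr_eq0.
by rewrite vw scalerA mulVf// scale1r.
Qed.

Lemma pgl_eq_trans : transitive pgl_eq.
Proof.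
move=> w v z /asboolP[c c0 vw] /asboolP[e e0 wz]; apply/asboolP.
by exists (c * e); rewrite ?mulf_neq0// vw wz scalerA.
Qed.

Canonical pgl_eq_equiv :=
  EquivRel pgl_eq pgl_eq_refl pgl_eq_sym pgl_eq_trans.

Definition PGL := quotient_topology {eq_quot pgl_eq}.
HB.instance Definition _ := Quotient.on PGL.
HB.instance Definition _ := Choice.on PGL.
HB.instance Definition _ := Topological.on PGL.

Lemma pgl_piP (g h : GL) :
  \pi_PGL g = \pi_PGL h <-> exists2 c : R, c != 0 & val g = c *: val h.
Proof.
split=> e.
  by have /eqquotP/asboolP : g = h %[mod {eq_quot pgl_eq}] by exact: e.
have /eqquotP ge : pgl_eq g h by exact/asboolP.
exact: ge.
Qed.

Lemma pgl_reprP (g : GL) :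
  exists2 c : R, c != 0 & val (repr (\pi_PGL g)) = c *: val g.
Proof. by apply/pgl_piP; rewrite reprK. Qed.

Definition PGL_one : PGL := \pi_PGL GL_one.
Definition PGL_mul (g h : PGL) : PGL := \pi_PGL (GL_mul (repr g) (repr h)).
Definition PGL_inv (g : PGL) : PGL := \pi_PGL (GL_inv (repr g)).

Lemma PGL_mul_pi (g h : GL) :
  PGL_mul (\pi_PGL g) (\pi_PGL h) = \pi_PGL (GL_mul g h).
Proof.
apply/pgl_piP; have [c c0 gE] := pgl_reprP g; have [e e0 hE] := pgl_reprP h.
by exists (c * e); rewrite ?mulf_neq0//= gE hE -scalemxAl -scalemxAr scalerA.
Qed.

Lemma PGL_inv_pi (g : GL) : PGL_inv (\pi_PGL g) = \pi_PGL (GL_inv g).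
Proof.
apply/pgl_piP; have [c c0 /= e] := pgl_reprP g.
by exists c^-1; rewrite ?invr_eq0//= e invmxZ// unitmxZ ?unitfE// GLP.
Qed.

Fact PGL_mulA : associative PGL_mul.
Proof.
elim/quotW=> g; elim/quotW=> h; elim/quotW=> k.
by rewrite (PGL_mul_pi h) !(PGL_mul_pi g) PGL_mul_pi GL_mulA.
Qed.

Fact PGL_mul1g : left_id PGL_one PGL_mul.
Proof. by elim/quotW=> g; rewrite PGL_mul_pi GL_mul1g. Qed.

Fact PGL_mulg1 : right_id PGL_one PGL_mul.
Proof. by elim/quotW=> g; rewrite PGL_mul_pi GL_mulg1. Qed.

Fact PGL_mulVg : left_inverse PGL_one PGL_inv PGL_mul.
Proof. by elim/quotW=> g; rewrite PGL_inv_pi PGL_mul_pi GL_mulVg. Qed.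

Fact PGL_mulgV : right_inverse PGL_one PGL_inv PGL_mul.
Proof. by elim/quotW=> g; rewrite PGL_inv_pi PGL_mul_pi GL_mulgV. Qed.

HB.instance Definition _ :=
  isGroup.Build PGL PGL_mulA PGL_mul1g PGL_mulg1 PGL_mulVg PGL_mulgV.

Fact GL_act_subproof (g : GL) (v : nzvec R d) : val g *m val v != 0.
Proof.
apply: contra (nzvecP v) => /eqP gv0.
by rewrite -(mulKmx (GLP g) (val v)) gv0 mulmx0.
Qed.

Definition GL_act (g : GL) (v : nzvec R d) : nzvec R d :=
  nzvec_of (GL_act_subproof g v).

Definition PGL_act (g : PGL) (p : pspace R d) : pspace R d :=
  \pi_(pspace R d) (GL_act (repr g) (repr p)).

Lemma PGL_act_pi (g : GL) (v : nzvec R d) :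
  PGL_act (\pi_PGL g) (\pi_(pspace R d) v) = \pi_(pspace R d) (GL_act g v).
Proof.
apply/proj_piP; have [c c0 gE] := pgl_reprP g; have [e e0 vE] := hvec_pi v.
by exists (c * e); rewrite ?mulf_neq0//= gE -/(hvec _) vE -scalemxAl -scalemxAr scalerA.
Qed.

End ProjectiveGroup.

Section ConvexProjective.
Variables (R : realType) (d : nat).
Local Notation P := (pspace R d).

Definition convex_in_chart (f : 'rV[R]_d) (A : set P) : Prop :=
  convex_set (chart_coord f @` A : set (convex_lmodType 'cV[R]_d)).

Definition properly_convex (Omega : set P) : Prop :=
  [/\ Omega !=set0, open Omega & exists f : 'rV[R]_d,
    [/\ closure Omega `<=` chart f,
        convex_in_chart f Omega,
        convex_in_chart f (closure Omega) &
        bounded_set (chart_coord f @` closure Omega)]].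

Definition proj_aut (Omega : set P) : set (PGL R d) :=
  [set g | PGL_act g @` Omega = Omega].

(** [r] is [1/2 log] of the cross-ratio of [a, x, y, b], for points [a, b] of
    the boundary such that [a, x, y, b] lie in this order on a line. Distances
    are measured in an affine chart containing the closure of [Omega]; the four
    points being collinear, the cross-ratio depends neither on the chart nor on
    the norm, here the sup norm of the library. *)
Definition is_hilbert_dist (Omega : set P) (x y : P) (r : R) : Prop :=
  exists (f : 'rV[R]_d) (a b : P),
    [/\ closure Omega `<=` chart f, boundary Omega a, boundary Omega b &
      let a' := chart_coord f a in let b' := chart_coord f b in
      let x' := chart_coord f x in let y' := chart_coord f y in
      (exists s t : R, [/\ 0 < s, s < t, t < 1,
        x' = a' + s *: (b' - a') & y' = a' + t *: (b' - a')]) /\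
      r = 2^-1 * ln ((`|a' - y'| * `|b' - x'|) / (`|a' - x'| * `|b' - y'|))].

(** Only meaningful for [x] and [y] in a properly convex [Omega], where the
    number selected by [xget] exists and is unique. *)
Definition hilbert_dist (Omega : set P) (x y : P) : R :=
  if x == y then 0 else xget 0 (is_hilbert_dist Omega x y).

(** Maps on [[0, +oo[] and on compact intervals are represented by total maps
    on [R], of which only the values on the interval are used. *)
Definition ray_image (c : R -> P) : set P := c @` [set t | 0 <= t].

Definition geodesic_ray (Omega : set P) (c : R -> P) : Prop :=
  (forall t, 0 <= t -> Omega (c t)) /\
  (forall s t, 0 <= s -> 0 <= t -> hilbert_dist Omega (c s) (c t) = `|s - t|).

(** The segment [[x, y)] is taken in an affine chart containing the closure
    of [Omega]. *)
Definition projective_geodesic_ray (Omega : set P) (c : R -> P) : Prop :=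
  geodesic_ray Omega c /\
  exists (f : 'rV[R]_d) (x y : P),
    [/\ closure Omega `<=` chart f, Omega x, boundary Omega y &
      chart_coord f @` ray_image c =
      [set (1 - t) *: chart_coord f x + t *: chart_coord f y
        | t in [set t : R | 0 <= t < 1]]].

(** Quasi-geodesics are not required to be continuous. *)
Definition quasi_geodesic (Omega : set P) (lam a s t : R) (q : R -> P) : Prop :=
  (forall u, s <= u <= t -> Omega (q u)) /\
  (forall u v, s <= u <= t -> s <= v <= t ->
    lam^-1 * `|u - v| - a <= hilbert_dist Omega (q u) (q v)
                          <= lam * `|u - v| + a).

Definition morse_gauge : Type := {nonneg R} -> {nonneg R} -> {nonneg R}.

(** [l] is the image of the geodesic. *)
Definition morse (Omega : set P) (M : morse_gauge) (l : set P) : Prop :=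
  forall (lam a : {nonneg R}) (s t : R) (q : R -> P),
    1 <= lam%:num -> s <= t ->
    quasi_geodesic Omega lam%:num a%:num s t q -> l (q s) -> l (q t) ->
    forall u, s <= u <= t ->
      exists2 p, l p & hilbert_dist Omega (q u) p <= (M lam a)%:num.

Definition tracks (Omega : set P) (r : R) (x0 : P) (c : R -> P)
    (gamma : nat -> PGL R d) : Prop :=
  forall n : nat,
    hilbert_dist Omega x0 (PGL_act ((gamma n)^-1)%g (c n%:R)) < r.

End ConvexProjective.

Section SingularValues.
Variables (R : realType) (d : nat).

(** The square roots of the eigenvalues of [g^T g], listed with multiplicity
    in nonincreasing order. *)
Definition is_singular_values (g : 'M[R]_d) (s : seq R) : Prop :=
  [/\ sorted >=%R s, all (>= 0) s &
      char_poly (g^T *m g) = \prod_(x <- s) ('X - (x ^+ 2)%:P)].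

Definition singular_values (g : 'M[R]_d) : seq R :=
  xget [::] (is_singular_values g).

(** Indices start at 1. *)
Definition sing_val (i : nat) (g : 'M[R]_d) : R := (singular_values g)`_i.-1.

Definition mu_gap (i j : nat) (g : PGL R d) : R :=
  ln (sing_val i (val (repr g)) / sing_val j (val (repr g))).

Definition divergent (g : nat -> PGL R d) : Prop :=
  forall K : set (PGL R d), compact K -> \forall n \near \oo, ~ K (g n).

Definition strongly_uniformly_regular_with (k : nat) (C : R) (N : nat)
    (g : nat -> PGL R d) : Prop :=
  divergent g /\
  forall n m : nat, (N < m)%N ->
    let h := ((g n)^-1 * g (n + m)%N)%g in mu_gap k k.+1 h / mu_gap 1 d h > C.

End SingularValues.

(* Main.v *)
(** Lift [Omega] to an open convex cone [C] of [R^d]. The Hilbert distance of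
    [x] and [y] is half the logarithm of the least [a * b] such that [a y - x]
    and [b x - y] lie in the closure of [C], and a segment of length [m] takes
    the form [A + B], [e^(-2m) A + B] with [A] and [B] on the boundary of [C].
    If [h] preserves [C] and [x0] is a base point, then
    [sigma_1(h) ~ |h x0|] and, by the minimax principle, [sigma_2(h)] is at most
    the size of [h] on the hyperplane mapped by [h] into a supporting hyperplane
    at [A]; that size is the width [w] of [C] at [h x0], transversally to the
    plane of [A] and [B].

    Along the segment [t |-> e^(-2t) A + B] this width is nonincreasing. If it
    were almost constant over a long window, then [C] would look there like
    the cone over a quadrant, and the path leaving the segment towards the
    boundary and coming back would be a (2,2)-quasi-geodesic with uniform
    constants going far away from the segment, against the Morse property.
    So the width decreases by a definite factor over each window of a length
    depending only on the Morse gauge, and [log (sigma_1 / sigma_2)] grows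
    linearly in [m], whereas [log (sigma_1 / sigma_d)] is [2 m + O(1)]. The case
    of [d - 1] follows by reversing the segment and replacing [h] by [h^-1]. *)
From HB Require Import structures.
Require Import Defs.
From mathcomp Require Import all_boot all_order all_algebra.
From mathcomp Require Import all_classical all_reals all_analysis.
From mathcomp Require Import ring lra perm complex spectral sesquilinear.
Import Order.TTheory GRing.Theory Num.Theory Num.Def.
Import numFieldNormedType.Exports.

Set Implicit Arguments.
Unset Strict Implicit.
Unset Printing Implicit Defensive.

Local Open Scope classical_set_scope.
Local Open Scope ring_scope.
Local Open Scope quotient_scope.

(** * Open convex cones *)

(** The difficulty is uniformity: [A] and [B] change with the ray and with the indices, while the
    constants must be fixed before the ray is given. Moving the segment by a lift of the inverse of
    [gamma n] puts its starting end within the tracking radius of the base point. All constants then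
    come from a ball around that point, a norm bound on the cone, and the tracking and Morse radii.
    Distances enter as strict cone inequalities, [cone_near]. These do not depend on the scaling of
    the representatives and are preserved by every matrix preserving the cone; the price is some
    slack, such as adding 1 to a radius. A window is controlled through supporting forms [al] at [A]
    and [be] at [B], and only widths in directions killed by both are compared. The same two forms
    bound distances along the test path from below, so its quasi-geodesic constants do not depend on
    the domain. The gap estimates concern pairs of indices and say nothing about compact sets of the
    group. Divergence is obtained separately: a compact set moves the base point a bounded distance,
    whereas the tracked points escape. *)

Definition form (R : realType) (d : nat) (f : 'rV[R]_d) (v : 'cV[R]_d) : R :=
  (f *m v) 0 0.

Section Form.
Variables (R : realType) (d : nat) (f : 'rV[R]_d).
Implicit Types v w : 'cV[R]_d.

Lemma formD v w : form f (v + w) = form f v + form f w.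
Proof. by rewrite /form mulmxDr mxE. Qed.

Lemma formZ a v : form f (a *: v) = a * form f v.
Proof. by rewrite /form -scalemxAr mxE. Qed.

Lemma formN v : form f (- v) = - form f v.
Proof. by rewrite /form mulmxN mxE. Qed.

Lemma formB v w : form f (v - w) = form f v - form f w.
Proof. by rewrite formD formN. Qed.

End Form.
Definition formE := (formD, formB, formN, formZ).

Ltac vec := apply/matrixP=> ? ?; rewrite !mxE.

Definition open_cone (R : realType) (d : nat) (C : set 'cV[R]_d) : Prop :=
  [/\ forall x y, C x -> C y -> C (x + y),
      forall t x, 0 < t -> C x -> C (t *: x),
      forall x, C x -> exists2 e, 0 < e & forall v, `|v| <= e -> C (x + v) &
      ~ C 0].

(** The closure of an open convex cone [C] is the set of [v] such that
    [C + v] is contained in [C]. *)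
Definition closed_hull (R : realType) (d : nat) (C : set 'cV[R]_d) : set 'cV[R]_d :=
  [set v | forall x, C x -> C (x + v)].

(** [cone_near C r x y] says that the lines spanned by [x] and [y] are at
    Hilbert distance less than [r]. *)
Definition cone_near (R : realType) (d : nat) (C : set 'cV[R]_d) (r : R)
    (x y : 'cV[R]_d) : Prop :=
  exists a b : R, [/\ 0 < a, 0 < b, a * b < expR (2 * r),
    C (a *: y - x) & C (b *: x - y)].

Section OpenCone.
Variables (R : realType) (d : nat) (C : set 'cV[R]_d).
Hypothesis CC : open_cone C.
Local Notation K := (closed_hull C).
Implicit Types (s t : R) (v w x y : 'cV[R]_d).

Lemma coneD x y : C x -> C y -> C (x + y).
Proof. by case: CC => + _ _ _; apply. Qed.

Lemma coneZ t x : 0 < t -> C x -> C (t *: x).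
Proof. by case: CC => _ + _ _; apply. Qed.

Lemma cone_open x : C x -> exists2 e, 0 < e & forall v, `|v| <= e -> C (x + v).
Proof. by case: CC => _ _ + _; apply. Qed.

Lemma cone0 : ~ C 0.
Proof. by case: CC. Qed.

Lemma coneZ_inv t x : 0 < t -> C (t *: x) -> C x.
Proof.
move=> t0 /(coneZ (t := t^-1)); rewrite invr_gt0 scalerA mulVf ?gt_eqF// scale1r.
exact.
Qed.

Lemma coneN x : C x -> ~ C (- x).
Proof. by move=> Cx CNx; apply: cone0; rewrite -(subrr x); exact: coneD. Qed.

Lemma cone_hull x : C x -> K x.
Proof. by move=> Cx y Cy; exact: coneD. Qed.

Lemma hullZ t x : 0 <= t -> K x -> K (t *: x).
Proof.
rewrite le_eqVlt => /orP[/eqP<- _ y|t0 Kx y Cy]; first by rewrite scale0r addr0.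
rewrite -[y]scale1r -(mulfV (lt0r_neq0 t0)) -scalerA -scalerDr.
by apply: coneZ => //; apply: Kx; apply: coneZ; rewrite ?invr_gt0.
Qed.

Lemma hullD x y : K x -> K y -> K (x + y).
Proof. by move=> Kx Ky z Cz; rewrite addrA; apply: Ky; exact: Kx. Qed.

Lemma coneD_hull x y : C x -> K y -> C (y + x).
Proof. by move=> Cx Ky; rewrite addrC; exact: Ky. Qed.

Lemma cone_between x v t : C (x + v) -> C (x - v) -> `|t| <= 1 -> C (x + t *: v).
Proof.
move=> Cp Cm; rewrite ler_norml => /andP[t1 t2].
have h2 z : C (2 *: z) -> C z by apply: coneZ_inv.
apply: h2.
have -> : 2 *: (x + t *: v) = (1 + t) *: (x + v) + (1 - t) *: (x - v).
  by vec; ring.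
move: t1; rewrite le_eqVlt => /orP[/eqP e|t1].
  rewrite -e subrr scale0r add0r; apply: coneZ => //; lra.
apply: (hullZ _ (cone_hull Cm)); first by lra.
by apply: coneZ => //; lra.
Qed.

Lemma cone_openZ x v : C x -> exists2 e, 0 < e & forall t, `|t| <= e -> C (x + t *: v).
Proof.
move=> Cx; have [e e0 He] := cone_open Cx.
exists (e / (1 + `|v|)) => [|t te].
  by rewrite divr_gt0// ltr_pwDl.
apply: He; rewrite normrZ; have v1 : 0 < 1 + `|v| by rewrite ltr_pwDl.
move: te; rewrite ler_pdivlMr// => te.
by apply: le_trans te; rewrite ler_wpM2l// lerDr.
Qed.

Lemma form_hull b x : (forall y, C y -> 0 < form b y) -> C !=set0 -> K x ->
  0 <= form b x.
Proof.
move=> b0 [y Cy] Kx; rewrite leNgt; apply/negP => bx; have by0 := b0 _ Cy.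
have t0 : 0 < - form b x / (2 * form b y) by rewrite divr_gt0 ?oppr_gt0 ?mulr_gt0.
have := b0 _ (Kx _ (coneZ t0 Cy)); rewrite !formE.
have -> : - form b x / (2 * form b y) * form b y + form b x = form b x / 2.
  by field; exact: lt0r_neq0.
lra.
Qed.

(** Two vectors of [C] with values of opposite signs would have a positive combination on which [g]
    vanishes. *)
Lemma form_sign g : C !=set0 -> (forall x, C x -> form g x != 0) ->
  exists2 s : R, s != 0 & forall x, C x -> 0 < s * form g x.
Proof.
move=> [v Cv] g0; exists (form g v) => [|w Cw]; first exact: g0.
rewrite ltNge le_eqVlt mulf_eq0 !negb_or !g0//=; apply/negP => vw.
have fv0 : 0 < form g v ^+ 2 by rewrite exprn_even_gt0//= g0.
have : C ((- (form g v * form g w)) *: v + (form g v ^+ 2) *: w).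
  by apply: coneD => //; apply: coneZ => //; rewrite oppr_gt0.
by move=> /g0; rewrite formD !formZ => /eqP; apply; ring.
Qed.

(* Among the matrices killing [x0] and vanishing nowhere on [C], take one of
   minimal rank; a connectedness argument shows that it has rank one. *)
Lemma supporting_form x0 : C !=set0 -> K x0 -> ~ C x0 ->
  exists b : 'rV[R]_d, (forall x, C x -> 0 < form b x) /\ form b x0 = 0.
Proof.
move=> [e Ce] Kx0 nCx0.
pose good (F : 'M[R]_d) := F *m x0 = 0 /\ forall x, C x -> F *m x != 0.
have [F0 gF0] : exists F, good F.
  (* The kernel of this matrix is the line of [x0]. It misses [C]: a vector of [C] on it would be a
     positive multiple of [x0], zero, or the opposite of a vector of [K]. *)
  exists (cokermx x0^T)^T; split.
    by apply: trmx_inj; rewrite trmx_mul trmxK mulmx_coker trmx0.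
  move=> x Cx; apply/negP => /eqP/(congr1 trmx).
  rewrite trmx_mul trmxK trmx0 => /eqP; rewrite -submxE => /sub_rVP[a].
  move=> /(congr1 trmx); rewrite trmxK linearZ/= trmxK => xE.
  case: (ltgtP a 0) => a0.
  - apply: cone0; have -> : 0 = x + (- a) *: x0 :> 'cV[R]_d.
      by rewrite xE scaleNr subrr.
    by apply: hullZ => //; rewrite oppr_ge0 ltW.
  - by apply: nCx0; apply: (coneZ_inv a0); rewrite -xE.
  - by apply: cone0; move: Cx; rewrite xE a0 scale0r.
pose Pr n := `[< exists2 F, good F & \rank F = n >].
have exPr : exists n, Pr n by exists (\rank F0); apply/asboolP; exists F0.
have [n /asboolP[F [Fx0 FC] rF] minF] := ex_minnP exPr.
(* [D] is the open cone [C + ker F]. *)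
pose D y := exists2 x, C x & F *m y = F *m x.
(* Composing [F] with a projection along [F *m y] lowers the rank, so by minimality the result is no
   longer good. It kills some vector of [C], whose image under [F] is then a nonzero multiple of
   [F *m y]. *)
have DE y : F *m y != 0 -> D y \/ D (- y).
  move=> Fy; have [i Fyi] : exists i, (F *m y) i 0 != 0.
    apply/existsP; apply: contraNT Fy => /existsPn Fy0; apply/eqP/colP => i.
    by rewrite [in RHS]mxE; apply/eqP; have := Fy0 i; rewrite negbK.
  pose phi : 'rV[R]_d := ((F *m y) i 0)^-1 *: delta_mx 0 i.
  have phiFy : phi *m (F *m y) = 1%:M.
    apply/matrixP => j k; rewrite !ord1 -scalemxAl -rowE [LHS]mxE [X in _ * X]mxE.
    by rewrite mulVf// mxE eqxx.
  pose F' := F - F *m y *m (phi *m F).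
  have F'y : F' *m y = 0.
    by rewrite mulmxBl -!mulmxA phiFy mulmx1 subrr.
  have F'x0 : F' *m x0 = 0 by rewrite mulmxBl -!mulmxA Fx0 !mulmx0 subrr.
  have [gF'|ngF'] := pselect (good F').
    have : (n <= \rank F')%N by apply: minF; apply/asboolP; exists F'.
    rewrite -rF => rFF'.
    have sF' : (F' <= F)%MS.
      rewrite /F' -[X in (X - _ <= _)%MS]mul1mx mulmxA -mulmxBl.
      exact: submxMl.
    have : (F <= F')%MS by rewrite -(geq_leqif (mxrank_leqif_sup sF')).
    move=> /submxP[G FE]; move: Fy; rewrite FE -mulmxA F'y mulmx0 eqxx.
    by [].
  have [x Cx F'x] : exists2 x, C x & F' *m x = 0.
    apply: contrapT => nx; apply: ngF'; split => // x Cx.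
    by apply/eqP => F'x; apply: nx; exists x.
  have [s Fx] : exists s, F *m x = s *: (F *m y).
    exists ((phi *m (F *m x)) 0 0).
    move: F'x; rewrite mulmxBl -!mulmxA => /eqP; rewrite subr_eq0 => /eqP E.
    by rewrite {1}E [X in y *m X]mx11_scalar mul_mx_scalar scalemxAr.
  have s0 : s != 0.
    by apply: contraNneq (FC _ Cx) => s0; rewrite Fx s0 scale0r.
  case: (ltgtP s 0) => [sn|sp|/eqP]; last by rewrite (negbTE s0).
    right; exists ((- s)^-1 *: x); first by apply: coneZ; rewrite ?invr_gt0 ?oppr_gt0.
    by rewrite -scalemxAr Fx scalerA invrN mulNr mulVf// scaleN1r mulmxN.
  left; exists (s^-1 *: x); first by apply: coneZ; rewrite ?invr_gt0.
  by rewrite -scalemxAr Fx scalerA mulVf// scale1r.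
have DN y : D y -> ~ D (- y).
  move=> [x Cx Fx] [x' Cx']; rewrite mulmxN Fx => /eqP.
  rewrite eq_sym -subr_eq0 opprK -mulmxDr addrC; apply/negP/FC; exact: coneD.
have Dopen y v : D y -> exists2 a, 0 < a & forall t, `|t| <= a -> D (y + t *: v).
  move=> [x Cx Fx]; have [a a0 Ha] := cone_openZ v Cx.
  exists a => // t ta; exists (x + t *: v); first exact: Ha.
  by rewrite !mulmxDr Fx.
(* Otherwise the line [y - t *: e] avoids [ker F], hence is covered by the disjoint open sets [D]
   and [- D]. Both of them meet it, and the supremum of [S] can belong to neither. *)
have Fspan y : exists s, F *m y = s *: (F *m e).
  apply: contrapT => ns.
  have Fye t : F *m (y - t *: e) != 0.
    apply/eqP => Fyt; apply: ns; exists t; apply/eqP.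
    by rewrite -subr_eq0 scalemxAr -mulmxBr Fyt.
  pose S : set R := [set t | D (y - t *: e)].
  have Sdown s t : S t -> s <= t -> S s.
    move=> [x Cx Fx] st; exists ((t - s) *: e + x).
      by apply: coneD_hull => //; apply: hullZ; [rewrite subr_ge0|exact: cone_hull].
    rewrite [RHS]mulmxDr -Fx -mulmxDr; congr (_ *m _); vec; ring.
  have [a a0 Ha] := cone_openZ y Ce.
  have S0 : S (- a^-1).
    exists (a^-1 *: (e + a *: y)).
      by apply: coneZ; [rewrite invr_gt0|apply: Ha; rewrite gtr0_norm].
    congr (_ *m _); vec; field; exact: lt0r_neq0.
  have S1 : ~ S (a^-1).
    move=> Sa; apply: (DN _ Sa); exists (a^-1 *: (e + (- a) *: y)).
      by apply: coneZ; [rewrite invr_gt0|apply: Ha; rewrite normrN gtr0_norm].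
    congr (_ *m _); vec; field; exact: lt0r_neq0.
  have hS : has_sup S.
    split; first by exists (- a^-1).
    exists a^-1 => t St; rewrite leNgt; apply/negP => /ltW at_.
    exact: S1 (Sdown _ _ St at_).
  case: (DE _ (Fye (sup S))) => DS.
    have [b b0 Hb] := Dopen _ e DS.
    have : S (sup S + b).
      rewrite /S/=; have -> : y - (sup S + b) *: e = y - sup S *: e + (- b) *: e.
        by vec; ring.
      by apply: Hb; rewrite normrN gtr0_norm.
    by move=> /(sup_upper_bound hS); rewrite gerDl leNgt b0.
  have [b b0 Hb] := Dopen _ e DS.
  have [t St tb] := sup_adherent b0 hS.
  have Sb : S (sup S - b) by apply: Sdown St (ltW tb).
  apply: (DN _ Sb).
  have -> : - (y - (sup S - b) *: e) = - (y - sup S *: e) + (- b) *: e.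
    by vec; ring.
  by apply: Hb; rewrite normrN gtr0_norm.
have [i Fei] : exists i, (F *m e) i 0 != 0.
  apply/existsP; apply: contraNT (FC _ Ce) => /existsPn Fy0; apply/eqP/colP => i.
  by rewrite [in RHS]mxE; apply/eqP; have := Fy0 i; rewrite negbK.
pose b := ((F *m e) i 0)^-1 *: row i F.
have bE y : form b y = ((F *m e) i 0)^-1 * (F *m y) i 0.
  by rewrite /form -scalemxAl -row_mul !mxE.
exists b; split; last by rewrite bE Fx0 [X in _ * X]mxE mulr0.
move=> x Cx; have [s Fx] := Fspan x.
have -> : form b x = s by rewrite bE Fx [X in _ * X]mxE mulrCA mulVf// mulr1.
rewrite ltNge; apply/negP => s0.
have : C (x - s *: e).
  rewrite -scaleNr; apply: hullZ => //; first by rewrite oppr_ge0.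
  exact: cone_hull.
by move=> /FC; rewrite mulmxBr Fx -scalemxAr subrr eqxx.
Qed.

End OpenCone.

(** * Windows along a Morse segment *)

(** The Morse property of [l] for (2,2)-quasi-geodesics, in terms of
    representative vectors. *)
Definition cone_morse (R : realType) (d : nat) (C : set 'cV[R]_d) (D : R)
    (l : set 'cV[R]_d) : Prop :=
  forall (T : R) (q : R -> 'cV[R]_d), 0 <= T ->
    (forall t, 0 <= t <= T -> C (q t)) ->
    (forall t t', 0 <= t <= T -> 0 <= t' <= T ->
       cone_near C (`|t - t'| + 2) (q t) (q t')) ->
    (forall t t' r, 0 <= t <= T -> 0 <= t' <= T ->
       cone_near C r (q t) (q t') -> `|t - t'| / 2 <= r) ->
    l (q 0) -> l (q T) ->
    forall t, 0 <= t <= T -> exists2 z, l z & cone_near C D (q t) z.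

Section Window.
Variables (R : realType) (d : nat) (C : set 'cV[R]_d) (CC : open_cone C).
Variables (A B : 'cV[R]_d) (al be : 'rV[R]_d).
Hypotheses (KA : closed_hull C A) (KB : closed_hull C B).
Hypotheses (al0 : forall x, C x -> 0 < form al x) (alA : form al A = 0).
Hypotheses (be0 : forall x, C x -> 0 < form be x) (beB : form be B = 0).
Hypotheses (alB : 0 < form al B) (beA : 0 < form be A).
Variables (D th : R) (l : set 'cV[R]_d).
Hypotheses (D0 : 0 < D) (th0 : 0 < th) (Ml : cone_morse C D l).
Hypothesis l_line : forall z, l z ->
  exists c h, [/\ 0 < c, 0 < h & z = c *: (h *: A + B)].
Hypothesis l_seg : forall h, th <= h <= 1 -> l (h *: A + B).

(** Time at which the test path is furthest from the chord. Exceeding [2 * D] makes [dl] smaller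
    than [expR (- (2 * D))], which is what the final contradiction in [window] uses. *)
Let len := 2 * D + 1.

Let mix (t : R) := Num.min t (2 * len - t).

Let mix_lip t t' : `|mix t - mix t'| <= `|t - t'|.
Proof.
rewrite /mix ler_norml.
have := ler_norm (t - t'); have := ler_norm (t' - t); rewrite (distrC t' t).
by move: (`|_|) => n; case: (leP t (2 * len - t)); case: (leP t' (2 * len - t'));
  move=> *; apply/andP; split; lra.
Qed.

(* [path t], seen in the chart [al = 1], leaves the line [(A, B)] towards the
   boundary in the direction [u] and comes back. *)
Let path H (u : 'cV[R]_d) (t : R) : 'cV[R]_d :=
  (H * expR (- t)) *: A + B + (1 - expR (- mix t)) *: u.

Let dl := expR (- len).

(** If the conclusion fails, [path] in the direction [v = (1 + dl / 2) *: u] is a quasi-geodesic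
    with ends on [l]. A point of [l] within [D] of its middle could be subtracted there with a
    coefficient large enough to put [H *: A + B + v] itself in [C]. *)
Lemma window (H : R) (u : 'cV[R]_d) :
  0 < H -> H <= 1 -> th <= H * expR (- (2 * len)) ->
  form al u = 0 -> form be u = 0 ->
  C ((H * (expR (- (2 * len)) / 2)) *: A + B + u) ->
  C ((H * (expR (- (2 * len)) / 2)) *: A + B - u) ->
  C (H *: A + B + (1 + dl / 2) *: u).
Proof.
move=> H0 H1 thH alu beu Cp Cm; apply: contrapT => nC.
set e2 := expR (- (2 * len)) in thH Cp Cm.
have e20 : 0 < e2 by exact: expR_gt0.
have dl0 : 0 < dl by exact: expR_gt0.
have len1 : 1 < len by rewrite /len ltrDr mulr_gt0.
have dl2 : dl < 1 / 2.
  rewrite /dl expRN -div1r ltr_pM2l// ltf_pV2 ?posrE ?expR_gt0//.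
  by apply: le_lt_trans (expR_gt1Dx _); rewrite ?gt_eqF//; lra.
have dlD : dl < expR (- (2 * D)) by rewrite ltr_expR /len; lra.
have [v vE] : exists v : 'cV[R]_d, v = (1 + dl / 2) *: u by exists ((1 + dl / 2) *: u).
have alv : form al v = 0 by rewrite vE formZ alu mulr0.
have bev : form be v = 0 by rewrite vE formZ beu mulr0.
have mixP t : 0 <= t <= 2 * len -> 0 <= mix t <= len.
  by move=> /andP[? ?]; rewrite /mix; case: (leP t _) => ?; apply/andP; split; lra.
(* The two hypotheses on [u] give a segment at the lowest height by convexity; adding multiples of
   [A] raises it to all greater heights. *)
have rect h X : e2 / 2 <= h -> `|X| * (1 + dl / 2) <= 1 ->
    C ((H * h) *: A + B + X *: v).
  move=> he Xe.
  have -> : (H * h) *: A + B + X *: v = (H * (e2 / 2)) *: A + B +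
    (X * (1 + dl / 2)) *: u + (H * (h - e2 / 2)) *: A by rewrite vE; vec; ring.
  apply: hullZ => //; first by rewrite mulr_ge0 ?subr_ge0// ltW.
  apply: cone_between => //; rewrite normrM (ger0_norm (_ : 0 <= 1 + dl / 2))//.
  lra.
have expl t : 0 <= t <= 2 * len -> e2 <= expR (- t).
  by move=> /andP[_ t2]; rewrite /e2 ler_expR; lra.
have expm t : 0 <= t <= 2 * len -> dl <= expR (- mix t) <= 1.
  move=> /mixP/andP[m0 ml]; rewrite -expR0 /dl !ler_expR.
  by apply/andP; split; lra.
have Cpath t : 0 <= t <= 2 * len -> C (path H v t).
  move=> tI; apply: rect; first by apply: le_trans (expl _ tI); lra.
  have /andP[m1 m2] := expm _ tI; rewrite ger0_norm ?subr_ge0//.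
  by nra.
(* The factor 3 is slack. The height [h] of the normalised difference stays above
   [2 / 3 * expR (- t)], hence above [e2 / 2], which is why the hypotheses of [window] start at half
   of [e2]. The transverse coefficient is at most [1 - 2 / 3 * dl], which compensates for
   [1 + dl / 2]. Since [3 < expR 2], the additive constant 2 is enough. *)
have up t t' : 0 <= t <= 2 * len -> 0 <= t' <= 2 * len ->
    C ((3 * expR `|t - t'|) *: path H v t - path H v t').
  move=> tI tI'; set E := expR `|t - t'|.
  have E1 : 1 <= E by rewrite -expR0 ler_expR.
  have ex a b : `|a - b| <= `|t - t'| -> expR (- b) <= E * expR (- a).
    move=> ab; rewrite -expRD ler_expR.
    by have := ler_norm (a - b); lra.
  pose n := 3 * E - 1; have n0 : 0 < n by rewrite /n; lra.
  have hE : expR (- t') <= E * expR (- t) by apply: ex.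
  have hm : expR (- mix t') <= E * expR (- mix t) by apply: ex; exact: mix_lip.
  have /andP[m1 m2] := expm _ tI; have et := expl _ tI.
  have m'0 := expR_gt0 (- mix t').
  pose h := (3 * E * expR (- t) - expR (- t')) / n.
  pose Y := (3 * E * expR (- mix t) - expR (- mix t')) / n.
  have -> : (3 * E) *: path H v t - path H v t' =
      n *: ((H * h) *: A + B + (1 - Y) *: v).
    rewrite /path /h /Y; vec; rewrite /n; field.
    by rewrite -/n lt0r_neq0.
  apply: coneZ => //; apply: rect.
    by rewrite /h ler_pdivlMr// /n; nra.
  have Y1 : 2 / 3 * expR (- mix t) <= Y by rewrite /Y ler_pdivlMr// /n; nra.
  have Y2 : Y <= 3 / 2 by rewrite /Y ler_pdivrMr// /n; nra.
  have : `|1 - Y| <= 1 - 2 / 3 * dl by rewrite ler_norml; apply/andP; split; lra.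
  by nra.
have lZ h : e2 <= h -> h <= 1 -> l ((H * h) *: A + B).
  by move=> h1 h2; apply: l_seg; apply/andP; split; nra.
have tI : 0 <= len <= 2 * len by apply/andP; split; lra.
have alpath t : form al (path H v t) = form al B.
  by rewrite /path !formE alA alv !mulr0 addr0 add0r.
have bepath t : form be (path H v t) = H * expR (- t) * form be A.
  by rewrite /path !formE beB bev mulr0 !addr0.
(* [al] is constant along the path and gives [1 < a]; [be] is proportional to [expR (- t)] and gives
   [expR (t - t') < b]. Distances are therefore at least half of the elapsed time, whence the
   multiplicative constant 2. *)
have sep r t t' : cone_near C r (path H v t) (path H v t') -> t' <= t ->
    t - t' < 2 * r.
  move=> [a [b [a0 b0 ab /al0 + /be0]]]; rewrite !formB !formZ !alpath !bepath => aa bb.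
  move=> tt'; rewrite -ltr_expR; apply: lt_trans ab.
  have a1 : 1 < a by move: aa; rewrite -[X in _ - X]mul1r -mulrBl pmulr_lgt0 ?subr_gt0.
  have : expR (- t') < b * expR (- t).
    move: bb; rewrite mulrA -mulrBl pmulr_lgt0// subr_gt0.
    by rewrite mulrCA ltr_pM2l.
  rewrite mulrC -ltr_pdivrMl ?expR_gt0// -expRN opprK -expRD => bt.
  by apply: (lt_trans bt); rewrite ltr_pMl.
have path0 : path H v 0 = (H * 1) *: A + B.
  rewrite /path /mix oppr0 expR0 addr0; case: leP => [_|?]; last by exfalso; lra.
  by rewrite oppr0 expR0 subrr scale0r addr0.
have pathT : path H v (2 * len) = (H * e2) *: A + B.
  rewrite /path /mix subrr; case: leP => [?|_]; first by exfalso; lra.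
  by rewrite oppr0 expR0 subrr scale0r addr0.
have e21 : e2 <= 1 by rewrite /e2 -[leRHS]expR0 ler_expR; lra.
have [|||||z lz] := @Ml (2 * len) (path H v) _ Cpath _ _ _ _ len tI.
- by lra.
- move=> t t' tI1 tI2; exists (3 * expR `|t - t'|), (3 * expR `|t - t'|).
  split; rewrite ?mulr_gt0 ?expR_gt0//.
  + rewrite [X in _ < expR X](_ : _ = (`|t - t'| + `|t - t'|) + (2 + 2)); last by ring.
    rewrite expRD [ltLHS](_ : _ = expR (`|t - t'| + `|t - t'|) * 9); last first.
      by rewrite expRD; ring.
    rewrite ltr_pM2l ?expR_gt0// expRD.
    have : (1 + 2 < expR 2 :> R) by apply: expR_gt1Dx.
    by nra.
  + by rewrite distrC; exact: up.
  + exact: up.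
- move=> t t' r _ _ near_tt'; rewrite ler_pdivrMr// [r * 2]mulrC.
  case: (leP t t') => tt'.
    rewrite distrC ger0_norm ?subr_ge0//.
    case: near_tt' => a [b [a0 b0 ab Ca Cb]]; apply/ltW/(@sep r) => //.
    by exists b, a; split => //; rewrite mulrC.
  by rewrite ger0_norm ?subr_ge0 1?ltW//; apply: sep => //; exact: ltW.
- by rewrite path0; apply: lZ.
- by rewrite pathT; apply: lZ.
have [c [h [c0 h0 ->]]] := l_line lz; move=> [a [b [a0 b0 ab Ca Cb]]].
apply: nC; rewrite -vE.
have mixl : mix len = len by rewrite /mix; case: leP => ?; lra.
(* [al] gives [1 < a * c], so [c / b] exceeds the inverse of [a * b], hence [expR (- (2 * D))] and
   then [dl]. *)
have bc : 1 - c / b < 1 - dl.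
  have := al0 Ca; rewrite formB !formZ formD formZ alpath alA mulr0 add0r => ac.
  have {}ac : 1 < a * c by move: ac; rewrite mulrA -[X in _ - X]mul1r -mulrBl pmulr_lgt0 ?subr_gt0.
  rewrite ltrD2l ltrN2; apply: lt_trans dlD _.
  rewrite expRN ltr_pdivlMr// ltr_pdivrMl ?expR_gt0//.
  by nra.
apply: (@coneZ_inv _ _ _ CC (1 - dl)); first lra.
(* At time [len] the coefficient of [v] is exactly [1 - dl], while removing the chord point leaves
   less than [1 - dl] of [B]. Nonnegative multiples of [A] and [B] fill the difference. *)
have -> : (1 - dl) *: (H *: A + B + v) =
    b^-1 *: (b *: path H v len - c *: (h *: A + B)) +
    (c * h / b) *: A + ((1 - dl - dl) * H) *: A + (1 - dl - (1 - c / b)) *: B.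
  rewrite /path mixl -/dl; vec; field; exact: lt0r_neq0.
apply: hullZ => //; first lra.
apply: hullZ => //; first by rewrite mulr_ge0; lra.
apply: hullZ => //; first by rewrite divr_ge0 ?mulr_ge0 ?ltW.
by apply: coneZ; rewrite ?invr_gt0.
Qed.

(* Each window multiplies the height by [expR (- 2 * len) / 2]. *)
Lemma window_iter (k : nat) (u : 'cV[R]_d) :
  2 * th <= (expR (- (2 * len)) / 2) ^+ k ->
  form al u = 0 -> form be u = 0 ->
  C ((expR (- (2 * len)) / 2) ^+ k *: A + B + u) ->
  C ((expR (- (2 * len)) / 2) ^+ k *: A + B - u) ->
  C (A + B + ((1 + dl / 2) ^+ k) *: u).
Proof.
elim: k u => [|k IHk] u; first by rewrite !expr0 !scale1r.
set s := expR (- (2 * len)) / 2.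
have s0 : 0 < s by rewrite divr_gt0 ?expR_gt0.
have s1 : s <= 1.
  have len1 : 1 < len by rewrite /len ltrDr mulr_gt0.
  have : expR (- (2 * len)) <= 1.
    rewrite -[leRHS]expR0 ler_expR oppr_le0 mulr_ge0//.
    by apply: ltW; apply: lt_trans len1.
  by rewrite /s; lra.
rewrite !exprSr => ths alu beu Cp Cm.
have sk0 : 0 < s ^+ k by rewrite exprn_gt0.
have thk : th <= s ^+ k * expR (- (2 * len)).
  have -> : expR (- (2 * len)) = 2 * s by rewrite /s mulrCA mulfV ?mulr1.
  rewrite mulrCA; have := th0; move: ths; lra.
have sk1 : s ^+ k <= 1 by rewrite exprn_ile1// ltW.
rewrite -scalerA; apply: IHk; rewrite ?formZ ?alu ?beu ?mulr0//.
- by apply: le_trans ths _; rewrite ger_pMr.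
- exact: window.
have : C (s ^+ k *: A + B + (1 + dl / 2) *: (- u)).
  by apply: window => //; rewrite ?formN ?alu ?beu ?oppr0 ?opprK.
by rewrite scalerN.
Qed.

End Window.

(** * Norm estimates for matrices preserving a cone *)

Section Estimates.
Variables (R : realType) (d : nat) (C : set 'cV[R]_d) (CC : open_cone C).
Variables (f : 'rV[R]_d) (k kf : R).
Hypotheses (k0 : 0 < k) (kf0 : 0 < kf).
Hypotheses (Ck : forall x, C x -> `|x| <= k * form f x).
Hypotheses (fk : forall x, form f x <= kf * `|x|).
Local Notation K := (closed_hull C).
Implicit Types x y v : 'cV[R]_d.

Lemma cone_nearZ r a b x y : 0 < a -> 0 < b ->
  cone_near C r (a *: x) (b *: y) -> cone_near C r x y.
Proof.
move=> a0 b0 [s [t [s0 t0 st C1 C2]]].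
exists (s * b / a), (t * a / b); split; rewrite ?divr_gt0 ?mulr_gt0//.
- by rewrite (_ : _ * _ = s * t)//; field; rewrite !lt0r_neq0.
- rewrite (_ : _ - _ = a^-1 *: (s *: (b *: y) - a *: x)).
    by apply: coneZ; rewrite ?invr_gt0.
  by vec; field; exact: lt0r_neq0.
- rewrite (_ : _ - _ = b^-1 *: (t *: (a *: x) - b *: y)).
    by apply: coneZ; rewrite ?invr_gt0.
  by vec; field; exact: lt0r_neq0.
Qed.

Lemma form_cone_gt0 x : C x -> 0 < form f x.
Proof.
move=> Cx; rewrite -(pmulr_rgt0 _ k0); apply: lt_le_trans (Ck Cx).
rewrite normr_gt0; apply: contraPneq Cx => ->; exact: cone0.
Qed.

Lemma hull_le x : C !=set0 -> K x -> `|x| <= k * form f x.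
Proof.
move=> [y Cy] Kx; apply/ler_addgt0Pr => e e0.
pose c := `|y| + k * form f y + 1.
have fy := form_cone_gt0 Cy.
have c0 : 0 < c by rewrite ltr_pwDr// addr_ge0// mulr_ge0 ?ltW.
pose t := e / c; have t0 : 0 < t by exact: divr_gt0.
have := Ck (Kx _ (coneZ CC t0 Cy)); rewrite formD formZ => h.
have : `|x| <= `|t *: y + x| + t * `|y|.
  by rewrite -[X in _ + X * _](gtr0_norm t0) -normrZ -{1}[x](addKr (t *: y)) addrC ler_normB.
have : t * c = e by rewrite divfK ?lt0r_neq0.
rewrite /c; nra.
Qed.

Lemma sym_bound x y : C (x + y) -> C (x - y) -> `|y| <= k * form f x.
Proof.
move=> /Ck + /Ck; rewrite !formE => h1 h2.
have : `|y + y| <= `|x + y| + `|x - y|.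
  by rewrite (_ : y + y = (x + y) - (x - y)); [exact: ler_normB|vec; ring].
rewrite -mulr2n normrMn; lra.
Qed.

Variables (x0 : 'cV[R]_d) (e : R).
Hypotheses (e0 : 0 < e) (Cx0 : C x0).
Hypothesis Ce : forall v, `|v| <= e -> C (x0 + v).

Lemma basept_ball v : C (x0 + (e / `|v|) *: v) /\ C (x0 - (e / `|v|) *: v).
Proof.
have le_e : `|(e / `|v|) *: v| <= e.
  rewrite normrZ ger0_norm; last by rewrite divr_ge0// ltW.
  have [->|v0] := eqVneq v 0; first by rewrite normr0 mulr0 ltW.
  by rewrite divfK// normr_eq0.
by split; apply: Ce; rewrite ?normrN.
Qed.

(** The ball of radius [e] around [x0] is mapped into [C], so a multiple of [g *m v] can be both
    added to and subtracted from [g *m x0]; [sym_bound] applies. *)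
Lemma cone_map_norm (g : 'M[R]_d) (v : 'cV[R]_d) :
  (forall x, C x -> C (g *m x)) ->
  `|g *m v| <= k * kf / e * `|v| * `|g *m x0|.
Proof.
move=> gC; have [->|v0] := eqVneq v 0; first by rewrite mulmx0 !normr0 mulr0 mul0r.
have nv0 : 0 < `|v| by rewrite normr_gt0.
have [] := basept_ball v; move=> /gC + /gC; rewrite mulmxDr mulmxBr => h1 h2.
have := sym_bound h1 h2; rewrite -scalemxAr normrZ gtr0_norm ?divr_gt0//.
rewrite mulrAC ler_pdivrMr// mulrC => h; rewrite -(ler_pM2l e0).
rewrite mulrC; apply: le_trans h _.
have := fk (g *m x0) => h.
rewrite [leRHS](_ : _ = k * (kf * `|g *m x0|) * `|v|); last first.
  by field; exact: lt0r_neq0.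
by rewrite ler_pM2r// ler_pM2l.
Qed.

(** The factor [b] of [cone_near] bounds [g *m x0], and applying [g'] to the other inequality shows
    that [a] bounds [g' *m x0]. Only the product [a * b] is controlled, which is why the two norms
    are multiplied. *)
Lemma near_norm r (g g' : 'M[R]_d) (v w : 'cV[R]_d) : cone_near C r x0 (g *m x0) ->
  (forall x, C x -> C (g *m x)) -> (forall x, C x -> C (g' *m x)) ->
  g' *m g = 1%:M ->
  `|g *m v| * `|g' *m w| <=
    (k * kf / e) ^+ 2 * (k * form f x0) ^+ 2 * expR (2 * r) * (`|v| * `|w|).
Proof.
move=> [a [b [a0 b0 ab Ca Cb]]] gC g'C g'g.
have c0 : 0 <= k * kf / e by rewrite divr_ge0 ?mulr_ge0 ?ltW.
have fx0 := form_cone_gt0 Cx0.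
have below c y : C y -> C (c *: x0 - y) -> `|y| <= c * (k * form f x0).
  move=> /Ck Cy /form_cone_gt0; rewrite formB formZ subr_gt0 => /ltW fy.
  by apply: le_trans Cy _; rewrite mulrCA ler_pM2l.
have h1 : `|g *m x0| <= b * (k * form f x0) by apply: below => //; exact: gC.
have h2 : `|g' *m x0| <= a * (k * form f x0).
  apply: below; first exact: g'C.
  by have := g'C _ Ca; rewrite mulmxBr -scalemxAr mulmxA g'g mul1mx.
have h3 := cone_map_norm v gC; have h4 := cone_map_norm w g'C.
apply: le_trans (ler_pM _ _ h3 h4) _ => //.
have : `|g *m x0| * `|g' *m x0| <= (k * form f x0) ^+ 2 * expR (2 * r).
  apply: le_trans (ler_pM _ _ h1 h2) _ => //.
  rewrite mulrACA -expr2 mulrC ler_pM2l ?exprn_gt0 ?mulr_gt0//.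
  by rewrite mulrC ltW.
have {}c0 : 0 <= (k * kf / e) ^+ 2 * (`|v| * `|w|) by apply: mulr_ge0; [exact: sqr_ge0|exact: mulr_ge0].
move=> /(ler_wpM2l c0); rewrite [X in X <= _ -> _](_ : _ = 
  k * kf / e * `|v| * `|g *m x0| * (k * kf / e * `|w| * `|g' *m x0|)); last by ring.
by move=> /le_trans; apply; rewrite le_eqVlt; apply/orP; left; apply/eqP; ring.
Qed.

Section Contraction.
Variables (r : R) (A B : 'cV[R]_d) (D th : R) (l : set 'cV[R]_d).
Hypotheses (KA : K A) (KB : K B) (nCA : ~ C A) (nCB : ~ C B).
Hypotheses (D0 : 0 < D) (th0 : 0 < th) (Ml : cone_morse C D l).
Hypothesis l_line : forall z, l z ->
  exists c h, [/\ 0 < c, 0 < h & z = c *: (h *: A + B)].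
Hypothesis l_seg : forall h, th <= h <= 1 -> l (h *: A + B).
Hypothesis CAB : C (A + B).

Let s := expR (- (2 * (2 * D + 1))) / 2.
Let eta := expR (- (2 * D + 1)) / 2.

(** Each of the two nearness hypotheses of [contraction] contributes [expR (2 * r)]. The middle
    factor compares [form f (A + B)] with [form f B]; [kf / e] accounts for the scaling of [v] to
    the ball at [x0] and for the return from [f] to the norm. *)
Definition contraction_constant : R :=
  kf / e * (k * form f x0 / e) * expR (4 * r).

(* The image of the unit ball under [g] has width governed by the Hilbert ball
   around [g x0], which is thin transversally to the line [(A, B)]. *)
Lemma contraction (n : nat) (g : 'M[R]_d) :
  2 * th <= s ^+ n ->
  cone_near C r x0 (A + B) -> cone_near C r (g *m x0) (th *: A + B) ->
  (forall x, C x -> C (g *m x)) ->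
  exists phi : 'rV[R]_d, forall v, phi *m v = 0 ->
    `|g *m v| <= contraction_constant * (k * ((1 + eta) ^- n + th)) * `|v| * `|g *m x0|.
Proof.
move=> thn near_p near_q gC.
have Cne : C !=set0 by exists x0.
have [al [al0 alA]] := supporting_form CC Cne KA nCA.
have [be [be0 beB]] := supporting_form CC Cne KB nCB.
have alB : 0 < form al B by have := al0 _ CAB; rewrite formD alA add0r.
have beA : 0 < form be A by have := be0 _ CAB; rewrite formD beB addr0.
have fA : 0 <= form f A by apply: (form_hull CC) KA => // y; exact: form_cone_gt0.
have fB : 0 <= form f B by apply: (form_hull CC) KB => // y; exact: form_cone_gt0.
have fP := form_cone_gt0 CAB.
have fx0 := form_cone_gt0 Cx0.
have eta0 : 0 < eta by rewrite divr_gt0 ?expR_gt0.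
have B0 : 0 < `|B|.
  by rewrite normr_gt0; apply: contraTneq alB => ->; rewrite /form mulmx0 mxE ltxx.
(* [B] is not small compared with [A + B], since the latter is near [x0], which has a ball of radius
   [e] in [C]: testing [al] on [x0 - (e / |B|) B] bounds [a * |B|] below by [e]. *)
have fBP : form f (A + B) <= (k * form f x0 / e) * expR (2 * r) * form f B.
  have [a [b [a0 b0 ab Ca Cb]]] := near_p.
  have aB : e <= a * `|B|.
    have [_ C0] := basept_ball B.
    have := al0 _ (coneD CC Ca C0); rewrite !formE alA add0r.
    rewrite addrA subrK -mulrBl pmulr_lgt0// subr_gt0 ltr_pdivrMr//.
    exact: ltW.
  have : form f (A + B) <= b * form f x0.
    by have := form_cone_gt0 Cb; rewrite formB formZ subr_gt0 => /ltW.
  move=> /le_trans; apply.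
  have Bf : `|B| <= k * form f B by exact: hull_le.
  have aB' : e <= a * (k * form f B) by apply: le_trans aB _; rewrite ler_pM2l.
  have fB0 : 0 < form f B by rewrite -(pmulr_rgt0 _ k0); exact: lt_le_trans Bf.
  rewrite [leRHS](_ : _ = (k * form f x0 * form f B * expR (2 * r)) / e); last by ring.
  rewrite ler_pdivlMr//; apply: (@le_trans _ _ (k * form f x0 * form f B * (a * b))).
    rewrite [leRHS](_ : _ = b * form f x0 * (a * (k * form f B))); last by ring.
    by rewrite ler_pM2l ?mulr_gt0.
  by rewrite ler_pM2l ?mulr_gt0// ltW.
exists (al *m g) => v alv.
have [->|v0] := eqVneq v 0; first by rewrite mulmx0 !normr0 mulr0 mul0r.
have nv0 : 0 < `|v| by rewrite normr_gt0.
have [a [b [a0 b0 ab Ca Cb]]] := near_q.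
(* With this scaling the image of the ball at [x0] shows that [u] can be added to and subtracted
   from [th *: A + B] inside [C]. *)
have [u uE] : exists u : 'cV[R]_d, u = (e / `|v| / a) *: (g *m v) by eexists.
have alu : form al u = 0.
  by rewrite uE formZ /form mulmxA alv mxE mulr0.
have [Cp Cm] : C (th *: A + B + u) /\ C (th *: A + B - u).
  have [/gC Cp /gC Cm] := basept_ball v; split; apply: (coneZ_inv CC a0).
    rewrite (_ : _ *: _ = a *: (th *: A + B) - g *m x0 + g *m (x0 + (e / `|v|) *: v)).
      exact: coneD.
    rewrite mulmxDr -scalemxAr uE; vec; field; apply/andP; split; exact: lt0r_neq0.
  rewrite (_ : _ *: _ = a *: (th *: A + B) - g *m x0 + g *m (x0 - (e / `|v|) *: v)).
    exact: coneD.
  rewrite mulmxBr -scalemxAr uE; vec; field; apply/andP; split; exact: lt0r_neq0.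
(* The windows need a direction killed by [be] as well as by [al]. The component along [A] has
   coefficient at most [th]; it is split off and produces the term [th] of the bound. *)
pose uA := form be u / form be A.
have [w wE] : exists w : 'cV[R]_d, w = u - uA *: A by eexists.
have uAE : form be u = uA * form be A by rewrite divfK// lt0r_neq0.
have uAth : `|uA| <= th.
  have := be0 _ Cp; have := be0 _ Cm; rewrite !formE beB addr0 uAE -mulrBl -mulrDl.
  rewrite !pmulr_lgt0// => h1 h2; rewrite ler_norml; apply/andP; split; lra.
have alw : form al w = 0 by rewrite wE formB formZ alA alu mulr0 subrr.
have bew : form be w = 0 by rewrite wE formB formZ uAE subrr.
move: (uAth); rewrite ler_norml => /andP[uA1 uA2].
have Cpw : C (s ^+ n *: A + B + w).
  rewrite (_ : _ + w = th *: A + B + u + (s ^+ n - th - uA) *: A); last by rewrite wE; vec; ring.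
  by apply: hullZ => //; lra.
have Cmw : C (s ^+ n *: A + B - w).
  rewrite (_ : _ - w = th *: A + B - u + (s ^+ n - th + uA) *: A); last by rewrite wE; vec; ring.
  by apply: hullZ => //; lra.
have iter z : form al z = 0 -> form be z = 0 -> C (s ^+ n *: A + B + z) ->
    C (s ^+ n *: A + B - z) -> C (A + B + (1 + eta) ^+ n *: z).
  exact: (window_iter CC KA KB al0 alA be0 beB alB beA D0 th0 Ml l_line l_seg thn).
have etan : 0 < (1 + eta) ^+ n by rewrite exprn_gt0// addr_gt0.
have wn : `|w| <= (1 + eta) ^- n * (k * form f (A + B)).
  rewrite ler_pdivlMl// -[X in X * _](gtr0_norm etan) -normrZ.
  apply: sym_bound; first exact: iter.
  rewrite -scalerN; apply: iter; rewrite ?formN ?alw ?bew ?oppr0 ?opprK//.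
have un : `|u| <= k * ((1 + eta) ^- n + th) * form f (A + B).
  rewrite (_ : u = w + uA *: A); last by rewrite wE subrK.
  apply: le_trans (ler_normD _ _) _; rewrite normrZ mulrDr mulrDl.
  apply: lerD; first by rewrite mulrAC mulrC.
  have An : `|A| <= k * form f (A + B).
    by apply: le_trans (hull_le Cne KA) _; rewrite formD ler_pM2l// lerDl.
  by rewrite mulrAC mulrC; apply: ler_pM.
(* This brings in [g *m x0]: it is near the far end, whose value under [f] is at least that of
   [B]. *)
have fBg : form f B <= b * (kf * `|g *m x0|).
  have := form_cone_gt0 Cb; rewrite !formE subr_gt0 => /ltW h.
  apply: (@le_trans _ _ (th * form f A + form f B)); first by rewrite lerDr mulr_ge0// ltW.
  by apply: le_trans h _; rewrite ler_pM2l.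
have gvE : `|g *m v| = `|v| / e * a * `|u|.
  rewrite uE normrZ gtr0_norm ?divr_gt0//; field.
  by rewrite !lt0r_neq0.
pose q := k * ((1 + eta) ^- n + th).
have q0 : 0 <= q by rewrite mulr_ge0 ?addr_ge0 ?invr_ge0// ltW.
rewrite gvE -/q /contraction_constant.
have -> : expR (4 * r) = expR (2 * r) * expR (2 * r) by rewrite -expRD; congr expR; ring.
set E := expR (2 * r) in ab fBP *; have E0 : 0 < E by exact: expR_gt0.
set kx := k * form f x0 / e in fBP *; have kx0 : 0 < kx by rewrite divr_gt0 ?mulr_gt0.
apply: (@le_trans _ _ (`|v| / e * a * (q * (kx * E * (b * (kf * `|g *m x0|)))))).
  apply: ler_wpM2l; first by rewrite ltW// mulr_gt0 ?divr_gt0.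
  apply: le_trans un _; rewrite ler_wpM2l//; apply: le_trans fBP _.
  by rewrite ler_pM2l; last exact: mulr_gt0.
rewrite [leLHS](_ : _ = kf / e * kx * E * q * `|v| * `|g *m x0| * (a * b)); last by ring.
rewrite [leRHS](_ : _ = kf / e * kx * E * q * `|v| * `|g *m x0| * E); last by ring.
apply: ler_wpM2l; last exact: ltW.
by do ![apply: mulr_ge0 => //]; rewrite ?invr_ge0 ltW.
Qed.

End Contraction.

End Estimates.

(** * Singular values *)

Section Spectrum.
Variables (R : realType) (d : nat).
Local Open Scope sesquilinear_scope.
Local Notation toC := (real_complex R).
Local Notation MtoC := (map_mx toC).

Definition sqnorm (v : 'cV[R]_d) : R := \sum_i v i 0 ^+ 2.

Definition csqnorm (w : 'cV[R[i]]_d) : R[i] := \sum_i `|w i 0| ^+ 2.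

Lemma sqnorm0 : sqnorm 0 = 0.
Proof. by rewrite /sqnorm big1// => i _; rewrite mxE expr0n. Qed.

Lemma csqnormE (w : 'cV[R[i]]_d) : csqnorm w = (w ^t* *m w) 0 0.
Proof. by rewrite mxE; apply: eq_bigr => i _; rewrite !mxE normCK mulrC. Qed.

Lemma csqnorm_real (v v' : 'cV[R]_d) :
  csqnorm (MtoC v + 'i *: MtoC v') = (sqnorm v + sqnorm v')%:C%C.
Proof.
rewrite /csqnorm /sqnorm -big_split/= raddf_sum/=; apply: eq_bigr => i _.
rewrite !mxE -add_Re2_Im2; congr (_ %:C)%C.
by rewrite -complexiE /=; congr (_ ^+ 2 + _ ^+ 2); rewrite /=; ring.
Qed.

(** Spectral theorem for the hermitian matrix [g^T *m g] over [R[i]]: [P] is unitary, and in the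
    coordinates [P *m w] both quadratic forms are diagonal. The eigenvalues are nonnegative because
    they are values of the second form. *)
Lemma gram_spectrum (g : 'M[R]_d) : exists (P : 'M[R[i]]_d) (x : 'I_d -> R),
  [/\ P \in unitmx, forall i, 0 <= x i,
      char_poly (g^T *m g) = \prod_i ('X - (x i)%:P),
      forall w, csqnorm w = \sum_i `|(P *m w) i 0| ^+ 2 &
      forall w, csqnorm (MtoC g *m w) = \sum_i (x i)%:C%C * `|(P *m w) i 0| ^+ 2].
Proof.
pose G := MtoC g; pose A := G^T *m G.
have Greal : G ^ conjC = G.
  by apply/matrixP => i j; rewrite !mxE; apply: conj_Creal; apply/complex_realP; exists (g i j).
have GT : G ^t* = G^T by rewrite -[in LHS]map_trmx Greal.
have AE : A = MtoC (g^T *m g) by rewrite map_mxM -map_trmx.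
have Ah : A \is hermsymmx.
  apply: realsym_hermsym.
    by apply/is_hermitianmxP; rewrite expr0 scale1r map_mx_id// trmx_mul trmxK.
  by rewrite AE; apply/mxOverP => i j; rewrite mxE; apply/complex_realP; eexists.
have /orthomx_spectralP AP := hermitian_normalmx Ah.
have Pu := spectral_unitarymx A.
have := hermitian_spectral_diag_real Ah.
move: (spectralmx A) (spectral_diag A) Pu AP => P D Pu AP Dreal.
have Pinv : P ^t* *m P = 1%:M.
  by rewrite -invmx_unitary// mulVmx// unitarymx_unit.
have n1 w : csqnorm w = csqnorm (P *m w).
  rewrite !csqnormE trmx_mul map_mxM -!mulmxA (mulmxA (P ^t*)) Pinv mul1mx.
  by [].
have DRe i : D 0 i = (complex.Re (D 0 i))%:C%C by rewrite RRe_real//; exact: (mxOverP Dreal).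
pose x i := complex.Re (D 0 i).
have n2 w : csqnorm (G *m w) = \sum_i (x i)%:C%C * `|(P *m w) i 0| ^+ 2.
  rewrite csqnormE trmx_mul map_mxM -!mulmxA (mulmxA (G ^t*)) GT -/A AP.
  rewrite invmx_unitary// -!mulmxA mulmxA -map_mxM -trmx_mul mxE.
  apply: eq_bigr => i _; rewrite mul_diag_mx [X in _ * X]mxE ![X in X * _]mxE.
  by rewrite -DRe normCK mulrCA; congr (_ * _); rewrite [_^T%R 0 i]mxE mulrC.
exists P, x; split => //.
- exact: unitarymx_unit.
- move=> i; pose w : 'cV[R[i]]_d := invmx P *m delta_mx i 0.
  have := n2 w; rewrite /w mulKVmx ?unitarymx_unit//.
  rewrite (bigD1 i)//= big1 => [|j ji].
    by rewrite mxE !eqxx normr1 expr1n mulr1 addr0 => xi; rewrite -ler0c -xi sumr_ge0.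
  by rewrite mxE (negbTE ji) normr0 expr0n mulr0.
- apply: (map_poly_inj toC); rewrite map_char_poly -AE AP.
  rewrite rmorph_prod/=.
  have -> : char_poly (invmx P *m diag_mx D *m P) = char_poly (diag_mx D).
    rewrite /char_poly /char_poly_mx.
    have Pu' := unitarymx_unit Pu.
    have -> : 'X%:M - map_mx polyC (invmx P *m diag_mx D *m P) =
        map_mx polyC (invmx P) *m ('X%:M - map_mx polyC (diag_mx D)) *m map_mx polyC P.
      rewrite !map_mxM mulmxBr mulmxBl; congr (_ - _).
      by rewrite mul_mx_scalar -scalemxAl -map_mxM mulVmx// map_mx1 scalemx1.
    rewrite !det_mulmx mulrAC -det_mulmx -map_mxM mulVmx// map_mx1 det1 mul1r.
    by [].
  rewrite char_poly_trig ?diag_mx_is_trig//.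
  apply: eq_bigr => i _; rewrite rmorphB/= map_polyX map_polyC/=.
  by rewrite mxE eqxx mulr1n DRe.
Qed.

(** Two factorisations of the same characteristic polynomial agree up to a permutation, which is
    applied to the rows of [P] to follow the sorted order. *)
Lemma singular_values_spectrum (g : 'M[R]_d) : exists P : 'M[R[i]]_d,
  let x (i : 'I_d) := (singular_values g)`_i ^+ 2 in
  [/\ P \in unitmx,
      forall w, csqnorm w = \sum_i `|(P *m w) i 0| ^+ 2,
      forall w, csqnorm (MtoC g *m w) = \sum_i (x i)%:C%C * `|(P *m w) i 0| ^+ 2,
      (forall i, 0 <= (singular_values g)`_i) &
      forall i j : nat, (i <= j < d)%N ->
        (singular_values g)`_j <= (singular_values g)`_i].
Proof.
have [P [x [Pu x0 charg n1 n2]]] := gram_spectrum g.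
have [s0 s1 s2] : is_singular_values g (singular_values g).
  apply: xgetPex; exists (sort >=%R [seq Num.sqrt (x i) | i <- enum 'I_d]); split.
  - by apply: sort_sorted => a b; exact: ge_total.
  - by apply/allP => y; rewrite mem_sort => /mapP[i _ ->]; exact: sqrtr_ge0.
  - rewrite (perm_big [seq Num.sqrt (x i) | i <- enum 'I_d])/=; last by rewrite perm_sort.
    rewrite big_map big_enum/= charg; apply: eq_bigr => i _.
    by rewrite sqr_sqrtr.
set s := singular_values g in s0 s1 s2 *.
have xs : perm_eq [seq y ^+ 2 | y <- s] [tuple x i | i < d].
  apply: prod_XsubC_eq; rewrite big_map -s2 charg.
  by rewrite big_tuple; apply: eq_bigr => i _; rewrite tnth_mktuple.
have sz : size s = d by have := perm_size xs; rewrite size_map size_tuple.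
have [p ps] := tuple_permP xs.
have sx (i : 'I_d) : s`_i ^+ 2 = x (p i).
  rewrite -(nth_map 0 0 (fun y => y ^+ 2)) ?sz// ps.
  by rewrite -tnth_nth !tnth_mktuple.
exists (row_perm p P); split.
- by rewrite row_permE unitmx_mul Pu unitmx_perm.
- move=> w; rewrite n1 (reindex_inj (@perm_inj _ p))/=; apply: eq_bigr => i _.
  by congr (`| _ | ^+ 2); rewrite !mxE; apply: eq_bigr => k _; rewrite !mxE.
- move=> w; rewrite n2 (reindex_inj (@perm_inj _ p))/=; apply: eq_bigr => i _.
  rewrite sx; congr (_ * `| _ | ^+ 2).
  by rewrite !mxE; apply: eq_bigr => k _; rewrite !mxE.
- move=> i; case: (ltnP i (size s)) => si; last by rewrite nth_default.
  exact: (allP s1 _ (mem_nth 0 si)).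
- move=> i j /andP[ij jd].
  have := sorted_leq_nth (rev_trans le_trans) (@lexx _ _) 0 s0.
  by apply; rewrite ?inE ?sz//; exact: leq_ltn_trans jd.
Qed.

Section Vectors.
Variables (g : 'M[R]_d) (P : 'M[R[i]]_d) (x : 'I_d -> R) (c1 c2 : R).
Hypotheses (Pu : P \in unitmx).
Hypothesis n1 : forall w, csqnorm w = \sum_i `|(P *m w) i 0| ^+ 2.
Hypothesis n2 : forall w,
  csqnorm (MtoC g *m w) = \sum_i (x i)%:C%C * `|(P *m w) i 0| ^+ 2.

Let weightE (w : 'cV[R[i]]_d) : c1%:C%C * csqnorm w + c2%:C%C * csqnorm (MtoC g *m w) =
  \sum_i (c1 + c2 * x i)%:C%C * `|(P *m w) i 0| ^+ 2.
Proof.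
rewrite n1 n2 !mulr_sumr -big_split/=; apply: eq_bigr => i _.
by rewrite mulrA -mulrDl rmorphD rmorphM.
Qed.

Let real_weight v v' : c1%:C%C * csqnorm (MtoC v + 'i *: MtoC v') +
    c2%:C%C * csqnorm (MtoC g *m (MtoC v + 'i *: MtoC v')) =
  (c1 * sqnorm v + c2 * sqnorm (g *m v) + (c1 * sqnorm v' + c2 * sqnorm (g *m v')))%:C%C.
Proof.
have -> : MtoC g *m (MtoC v + 'i *: MtoC v') = MtoC (g *m v) + 'i *: MtoC (g *m v').
  by rewrite mulmxDr -(scalemxAr 'i) 2!map_mxM.
rewrite (csqnorm_real v v') (csqnorm_real (g *m v) (g *m v')).
rewrite -2!rmorphM -rmorphD.
by congr (_%:C)%C; ring.
Qed.

Lemma weight_ge0 v : (forall i, 0 <= c1 + c2 * x i) ->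
  0 <= c1 * sqnorm v + c2 * sqnorm (g *m v).
Proof.
move=> c0; have := weightE (MtoC v + 'i *: MtoC 0); rewrite real_weight.
rewrite mulmx0 sqnorm0 !mulr0 !addr0 => e; rewrite -ler0c e sumr_ge0// => i _.
by rewrite mulr_ge0 ?ler0c// exprn_ge0.
Qed.

(** Return from complex to real vectors: the form has real coefficients, so its value at [w] is the
    sum of its values at the real and imaginary parts, both killed by [phi]. One of them is nonzero
    with a nonnegative value. Suitable signs of [c1] and [c2] turn this into a lower or an upper
    bound for [g] on that vector. *)
Lemma weight_vector (m : nat) (phi : 'M[R]_(m, d)) (w : 'cV[R[i]]_d) :
  w != 0 -> MtoC phi *m w = 0 ->
  (forall i, 0 <= c1 + c2 * x i \/ (P *m w) i 0 = 0) ->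
  exists v, [/\ v != 0, phi *m v = 0 & 0 <= c1 * sqnorm v + c2 * sqnorm (g *m v)].
Proof.
move=> w0 phiw wi.
pose v := map_mx (@complex.Re R) w; pose v' := map_mx (@complex.Im R) w.
have wE : w = MtoC v + 'i *: MtoC v'.
  by apply/matrixP => i j; rewrite !mxE -complexiE -complexE.
have : 0 <= c1%:C%C * csqnorm w + c2%:C%C * csqnorm (MtoC g *m w).
  rewrite weightE sumr_ge0// => i _; case: (wi i) => [ci|->].
    by rewrite mulr_ge0 ?ler0c// exprn_ge0.
  by rewrite normr0 expr0n mulr0.
rewrite wE real_weight ler0c => ge0.
have [phiv phiv'] : phi *m v = 0 /\ phi *m v' = 0.
  move: phiw; rewrite wE mulmxDr -scalemxAr -!map_mxM => /matrixP phiw.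
  split; apply/matrixP => i j; have := phiw i j; rewrite !mxE -complexiE;
    move/eqP; rewrite eq_complex/= !mul0r !mulr0 ?mul1r subr0 !add0r addr0;
    by move=> /andP[/eqP ? /eqP ?].
have [v0|v0] := eqVneq v 0.
  exists v'; split => //.
    by apply: contraNneq w0 => v'0; rewrite wE v0 v'0 !map_mx0 scaler0 addr0.
  by move: ge0; rewrite v0 mulmx0 sqnorm0 !mulr0 !add0r.
have [ge0v|lt0v] := leP 0 (c1 * sqnorm v + c2 * sqnorm (g *m v)).
  by exists v.
have [v'0|v'0] := eqVneq v' 0.
  exists v; split => //.
  by move: ge0; rewrite v'0 mulmx0 sqnorm0 !mulr0 !addr0.
by exists v'; split => //; lra.
Qed.

Lemma weight_vector1 (i : 'I_d) : 0 <= c1 + c2 * x i ->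
  exists v, v != 0 /\ 0 <= c1 * sqnorm v + c2 * sqnorm (g *m v).
Proof.
move=> ci; pose w : 'cV[R[i]]_d := invmx P *m delta_mx i 0.
have PwE : P *m w = delta_mx i 0 by rewrite mulKVmx.
have [||j|v [v0 _ vge]] := @weight_vector 1 0 w; last by exists v.
- apply: contraTneq isT => w0; move/matrixP/(_ i 0): PwE.
  by rewrite w0 mulmx0 !mxE !eqxx => /esym/eqP; rewrite oner_eq0.
- by rewrite map_mx0 mul0mx.
- rewrite PwE mxE andbT; case: eqP => [->|_]; [by left|by right].
Qed.

(** The plane spanned by two eigenvectors meets the kernel of one linear form. *)
Lemma weight_vector2 (phi : 'rV[R]_d) (i j : 'I_d) : i != j ->
  0 <= c1 + c2 * x i -> 0 <= c1 + c2 * x j ->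
  exists v, [/\ v != 0, phi *m v = 0 & 0 <= c1 * sqnorm v + c2 * sqnorm (g *m v)].
Proof.
move=> ij ci cj.
pose a := (MtoC phi *m (invmx P *m delta_mx i 0 : 'cV_d)) 0 0.
pose b := (MtoC phi *m (invmx P *m delta_mx j 0 : 'cV_d)) 0 0.
have [s [t [st abst]]] : exists s t : R[i], (s != 0 \/ t != 0) /\ s * a + t * b = 0.
  have [a0|a0] := eqVneq a 0.
    by exists 1, 0; rewrite a0 mulr0 mul0r addr0 oner_eq0; split => //; left.
  by exists b, (- a); split; [right; rewrite oppr_eq0|ring].
pose w : 'cV[R[i]]_d := invmx P *m (s *: delta_mx i 0 + t *: delta_mx j 0).
have PwE : P *m w = s *: delta_mx i 0 + t *: delta_mx j 0 by rewrite mulKVmx.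
apply: (@weight_vector 1 phi w).
- apply: contraTneq isT => w0; move: PwE; rewrite w0 mulmx0 => /matrixP e.
  have := e i 0; have := e j 0; rewrite !mxE !eqxx/= (negbTE ij) eq_sym (negbTE ij).
  by rewrite !mulr0 !mulr1 addr0 add0r => t0 s0; case: st; rewrite -?s0 -?t0 eqxx.
- apply/matrixP => k l; rewrite !ord1 /w [RHS]mxE -abst.
  rewrite mulmxDr -(scalemxAr s) -(scalemxAr t) mulmxDr -(scalemxAr s) -(scalemxAr t).
  by rewrite [LHS]mxE [X in X + _]mxE [X in _ + X]mxE.
- move=> k; have [->|ki] := eqVneq k i; first by left.
  have [->|kj] := eqVneq k j; first by left.
  by right; rewrite PwE !mxE (negbTE ki) (negbTE kj)/= !mulr0 addr0.
Qed.

End Vectors.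

End Spectrum.

(** * Singular value gaps from norm inequalities *)

Section Gaps.
Variables (R : realType) (d : nat).
Implicit Types (v w x : 'cV[R]_d) (g : 'M[R]_d).

Lemma coord_le_norm v i : `|v i 0| <= `|v|.
Proof.
by rewrite [leRHS]/normr/= mx_normrE; apply/bigmax_geP; right; exists (i, 0).
Qed.

Lemma norm_le_coord v c : 0 <= c -> (forall i, `|v i 0| <= c) -> `|v| <= c.
Proof.
move=> c0 vc; rewrite [leLHS]/normr/= mx_normrE; apply/bigmax_leP; split => //.
by move=> [i j] _; rewrite ord1.
Qed.

Lemma sqnorm_ge0 v : 0 <= sqnorm v.
Proof. by apply: sumr_ge0 => i _; exact: sqr_ge0. Qed.

Lemma sqnorm_ge v : `|v| ^+ 2 <= sqnorm v.
Proof.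
rewrite -[leRHS]sqr_sqrtr ?sqnorm_ge0// ler_pXn2r ?nnegrE ?sqrtr_ge0//.
apply: norm_le_coord => [|i]; first exact: sqrtr_ge0.
rewrite -sqrtr_sqr ler_wsqrtr// /sqnorm (bigD1 i)//= lerDl.
by apply: sumr_ge0 => j _; exact: sqr_ge0.
Qed.

Lemma sqnorm_le v : sqnorm v <= d%:R * `|v| ^+ 2.
Proof.
have -> : d%:R * `|v| ^+ 2 = \sum_(i < d) `|v| ^+ 2.
  by rewrite sumr_const card_ord mulr_natl.
apply: ler_sum => i _.
by rewrite -real_normK ?num_real// ler_pXn2r ?nnegrE// coord_le_norm.
Qed.

Lemma sqnorm_gt0 v : v != 0 -> 0 < sqnorm v.
Proof.
by move=> v0; apply: lt_le_trans (sqnorm_ge v); rewrite exprn_gt0// normr_gt0.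
Qed.

Lemma form_le_norm (f : 'rV[R]_d) v : form f v <= (\sum_j `|f 0 j|) * `|v|.
Proof.
rewrite /form mxE mulr_suml; apply: ler_sum => j _.
by apply: le_trans (ler_norm _) _; rewrite normrM ler_wpM2l// coord_le_norm.
Qed.

Local Notation sv g i := ((singular_values g)`_i).

(** Minimax: some nonzero [v] in the kernel of [phi] is stretched at least by the second singular
    value, while [x] is stretched at most by the first. The factor [d] comes from comparing the sup
    norm with the Euclidean one. *)
Lemma gap_top g x t (phi : 'rV[R]_d) : (1 < d)%N -> 0 <= t ->
  (forall v, phi *m v = 0 -> `|g *m v| <= t * `|v| * `|g *m x|) ->
  sv g 1 ^+ 2 <= d%:R * t ^+ 2 * sqnorm x * sv g 0 ^+ 2.
Proof.
move=> d1 t0 gphi.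
have [P /= [Pu n1 n2 s0 sle]] := singular_values_spectrum g.
have d0 : (0 < d)%N by exact: ltnW.
have s10 : sv g 1 ^+ 2 <= sv g 0 ^+ 2 by rewrite ler_pXn2r ?nnegrE// sle.
have [||v [v0 phiv vge]] := @weight_vector2 _ _ g P _ (- sv g 1 ^+ 2) 1 Pu n1 n2
  phi (Ordinal d0) (Ordinal d1) isT; [by rewrite /=; lra|by rewrite /=; lra|].
have top w : sqnorm (g *m w) <= sv g 0 ^+ 2 * sqnorm w.
  have : 0 <= sv g 0 ^+ 2 * sqnorm w + - 1 * sqnorm (g *m w).
    apply: (weight_ge0 (P := P)) n1 n2 _ _ => i.
    by rewrite mulN1r subr_ge0 ler_pXn2r ?nnegrE// sle/=.
  lra.
rewrite -(ler_pM2r (sqnorm_gt0 v0)).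
have h1 : sv g 1 ^+ 2 * sqnorm v <= sqnorm (g *m v) by lra.
have h2 : `|g *m v| ^+ 2 <= (t * `|v| * `|g *m x|) ^+ 2.
  by rewrite ler_pXn2r ?nnegrE ?mulr_ge0// gphi.
have h3 : (t * `|v| * `|g *m x|) ^+ 2 <= t ^+ 2 * (sqnorm v * sqnorm (g *m x)).
  rewrite !exprMn -mulrA ler_wpM2l ?sqr_ge0//.
  by apply: ler_pM; rewrite ?sqr_ge0 ?sqnorm_ge.
apply: le_trans h1 _; apply: le_trans (sqnorm_le _) _.
rewrite [leRHS](_ : _ =
  d%:R * (t ^+ 2 * (sqnorm v * (sv g 0 ^+ 2 * sqnorm x)))); last by ring.
apply: ler_wpM2l => //; apply: le_trans h2 (le_trans h3 _).
by apply: ler_wpM2l; [exact: sqr_ge0|apply: ler_wpM2l; [exact: sqnorm_ge0|exact: top]].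
Qed.

(** Analogue of [gap_top] for the inverse matrix, written without the inverse: [v] stands for the
    preimage of [g *m v], and [w] for that of [x]. *)
Lemma gap_bottom g x w t (phi : 'rV[R]_d) : (1 < d)%N -> 0 <= t -> g *m w = x ->
  (forall v, phi *m v = 0 -> `|v| <= t * `|g *m v| * `|w|) ->
  sv g d.-1 ^+ 2 <= d%:R * t ^+ 2 * sqnorm x * sv g d.-2 ^+ 2.
Proof.
move=> d1 t0 gw gphi.
have [P /= [Pu n1 n2 s0 sle]] := singular_values_spectrum g.
have d0 : (0 < d)%N by exact: ltnW.
have d2 : (d.-2 < d)%N by rewrite -subn2 ltn_subrL.
have d1' : (d.-1 < d)%N by rewrite ltn_predL.
have s10 : sv g d.-1 ^+ 2 <= sv g d.-2 ^+ 2.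
  by rewrite ler_pXn2r ?nnegrE// sle// leq_pred.
have ij : Ordinal d1' != Ordinal d2.
  by rewrite -val_eqE/= gtn_eqF// prednK// -subn1 subn_gt0.
have [||v [v0 phiv vge]] := @weight_vector2 _ _ g P _ (sv g d.-2 ^+ 2) (-1) Pu n1 n2
  phi _ _ ij; [by rewrite /=; lra|by rewrite /=; lra|].
have bot : sv g d.-1 ^+ 2 * sqnorm w <= sqnorm x.
  have : 0 <= - sv g d.-1 ^+ 2 * sqnorm w + 1 * sqnorm (g *m w).
    apply: (weight_ge0 (P := P)) n1 n2 _ _ => i.
    rewrite mul1r addrC subr_ge0 ler_pXn2r ?nnegrE// sle//.
    by rewrite d1' andbT -ltnS prednK// ltn_ord.
  by rewrite gw; lra.
have h2 : `|v| ^+ 2 <= (t * `|g *m v| * `|w|) ^+ 2.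
  by rewrite ler_pXn2r ?nnegrE ?mulr_ge0// gphi.
have h3 : (t * `|g *m v| * `|w|) ^+ 2 <= t ^+ 2 * (sqnorm (g *m v) * sqnorm w).
  rewrite !exprMn -mulrA ler_wpM2l ?sqr_ge0//.
  by apply: ler_pM; rewrite ?sqr_ge0 ?sqnorm_ge.
have h4 : sqnorm (g *m v) <= sv g d.-2 ^+ 2 * sqnorm v by lra.
have h5 : 1 <= d%:R * t ^+ 2 * sv g d.-2 ^+ 2 * sqnorm w.
  rewrite -(ler_pM2r (sqnorm_gt0 v0)) mul1r.
  apply: le_trans (sqnorm_le _) _; rewrite [leRHS](_ : _ =
    d%:R * (t ^+ 2 * (sv g d.-2 ^+ 2 * sqnorm v * sqnorm w))); last by ring.
  apply: ler_wpM2l => //; apply: le_trans h2 (le_trans h3 _).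
  by apply: ler_wpM2l; [exact: sqr_ge0|apply: ler_wpM2r; [exact: sqnorm_ge0|]].
rewrite [leRHS](_ : _ = d%:R * t ^+ 2 * sv g d.-2 ^+ 2 * sqnorm x); last by ring.
apply: (@le_trans _ _ (d%:R * t ^+ 2 * sv g d.-2 ^+ 2 * (sv g d.-1 ^+ 2 * sqnorm w))).
  rewrite [leRHS](_ : _ = sv g d.-1 ^+ 2 * (d%:R * t ^+ 2 * sv g d.-2 ^+ 2 * sqnorm w)).
    by rewrite ler_peMr ?sqr_ge0.
  by ring.
by apply: ler_wpM2l => //; rewrite !mulr_ge0 ?sqr_ge0.
Qed.

Lemma sv_ratio g t : (0 < d)%N -> 0 <= t ->
  (forall v w, `|g *m v| * `|w| <= t * (`|v| * `|g *m w|)) ->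
  sv g 0 ^+ 2 <= (d%:R * t) ^+ 2 * sv g d.-1 ^+ 2.
Proof.
move=> d0 t0 gt.
have [P /= [Pu n1 n2 s0 sle]] := singular_values_spectrum g.
have d1' : (d.-1 < d)%N by rewrite ltn_predL.
have [|v [v0 vge]] := @weight_vector1 _ _ g P _ (- sv g 0 ^+ 2) 1 Pu n1 n2
  (Ordinal d0); first by rewrite /=; lra.
have [|w [w0 wge]] := @weight_vector1 _ _ g P _ (sv g d.-1 ^+ 2) (-1) Pu n1 n2
  (Ordinal d1'); first by rewrite /=; lra.
rewrite -(ler_pM2r (sqnorm_gt0 v0)) -(ler_pM2r (sqnorm_gt0 w0)).
apply: (@le_trans _ _ (sqnorm (g *m v) * sqnorm w)).
  by rewrite ler_wpM2r ?sqnorm_ge0//; lra.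
apply: (@le_trans _ _ ((d%:R * t) ^+ 2 * (sqnorm v * sqnorm (g *m w)))); last first.
  rewrite [leRHS](_ : _ = (d%:R * t) ^+ 2 * (sqnorm v * (sv g d.-1 ^+ 2 * sqnorm w))); last by ring.
  by apply: ler_wpM2l; [exact: sqr_ge0|apply: ler_wpM2l; [exact: sqnorm_ge0|lra]].
apply: le_trans (ler_pM (sqnorm_ge0 _) (sqnorm_ge0 _) (sqnorm_le _) (sqnorm_le _)) _.
rewrite [leLHS](_ : _ = d%:R ^+ 2 * (`|g *m v| * `|w|) ^+ 2); last by ring.
rewrite [X in _ <= X * _]exprMn -[leRHS]mulrA; apply: ler_wpM2l; first exact: sqr_ge0.
apply: (@le_trans _ _ ((t * (`|v| * `|g *m w|)) ^+ 2)).
  by rewrite ler_pXn2r ?nnegrE ?mulr_ge0// gt.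
rewrite [leLHS]exprMn; apply: ler_wpM2l; first exact: sqr_ge0.
by rewrite exprMn; apply: ler_pM; rewrite ?sqr_ge0 ?sqnorm_ge.
Qed.

Lemma sv_gt0 g i : g \in unitmx -> (i < d)%N -> 0 < sv g i.
Proof.
move=> gu id.
have [P /= [Pu n1 n2 s0 sle]] := singular_values_spectrum g.
rewrite lt_neqAle s0 andbT eq_sym; apply/eqP => si.
have [|v [v0 vge]] := @weight_vector1 _ _ g P _ 0 (-1) Pu n1 n2 (Ordinal id).
  by rewrite /= si; lra.
have : g *m v != 0 by apply: contra v0 => /eqP gv; rewrite -(mulKmx gu v) gv mulmx0.
by move=> /sqnorm_gt0; lra.
Qed.

End Gaps.

(** * Projective space and cones *)

Section Represents.
Variables (R : realType) (d : nat).
Local Notation P := (pspace R d).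
Implicit Types (p q : P) (v w : 'cV[R]_d) (f : 'rV[R]_d).

Definition represents p v : Prop := exists2 a : R, a != 0 & v = a *: hvec p.

Lemma represents_hvec p : represents p (hvec p).
Proof. by exists 1; rewrite ?oner_eq0// scale1r. Qed.

Lemma representsZ p v a : a != 0 -> represents p v -> represents p (a *: v).
Proof. by move=> a0 [b b0 ->]; exists (a * b); rewrite ?mulf_neq0// scalerA. Qed.

Lemma represents_neq0 p v : represents p v -> v != 0.
Proof. by move=> [a a0 ->]; rewrite scaler_eq0 negb_or a0 nzvecP. Qed.

Lemma represents_collinear p v w : represents p v -> represents p w ->
  exists2 a : R, a != 0 & w = a *: v.
Proof.
move=> [a a0 ->] [b b0 ->]; exists (b / a); rewrite ?mulf_neq0 ?invr_eq0//.
by rewrite scalerA divfK.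
Qed.

Lemma represents_pi (v : nzvec R d) : represents (\pi_P v) (val v).
Proof.
have [c c0 e] := hvec_pi v; exists c^-1; rewrite ?invr_eq0// e scalerA.
by rewrite mulVf// scale1r.
Qed.

Lemma represents_ex v : v != 0 -> exists p, represents p v.
Proof. by move=> v0; exists (\pi_P (nzvec_of v0)); exact: represents_pi. Qed.

Lemma represents_inj p q v : represents p v -> represents q v -> p = q.
Proof.
move=> [a a0 ->] [b b0 e]; rewrite -[p]reprK -[q]reprK; apply/proj_piP.
exists (a^-1 * b); rewrite ?mulf_neq0 ?invr_eq0//.
by rewrite -scalerA -[RHS]/(a^-1 *: (b *: hvec q)) -e scalerA mulVf// scale1r.
Qed.

Lemma represents_form f p v : represents p v -> chart f p -> form f v != 0.
Proof. by move=> [a a0 ->] fp; rewrite formZ mulf_neq0. Qed.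

Lemma chart_coordE f p v : represents p v -> chart_coord f p = (form f v)^-1 *: v.
Proof.
move=> [a a0 ->]; rewrite formZ scalerA invfM mulrAC mulVf// mul1r.
by [].
Qed.

Lemma represents_chart f p : chart f p -> represents p (chart_coord f p).
Proof. by move=> fp; exists (form f (hvec p))^-1; rewrite ?invr_eq0. Qed.

Lemma form_chart_coord f p : chart f p -> form f (chart_coord f p) = 1.
Proof. by move=> fp; rewrite formZ mulVf. Qed.

Lemma open_represents (U : set P) p v : open U -> U p -> represents p v ->
  exists2 e : R, 0 < e & forall w, `|w| <= e ->
    v + w != 0 /\ forall q, represents q (v + w) -> U q.
Proof.
move=> [B oB BU] Up pv; have v0 := represents_neq0 pv.
have Bv : B v.
  have -> : v = val (nzvec_of v0) by [].
  rewrite -[B _]/((val @^-1` B) _) BU/=.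
  by rewrite -(represents_inj pv (represents_pi (nzvec_of v0))).
have [e /= e0 He] := (iffLR (@nbhs_ballP _ _ v B) (open_nbhs_nbhs (conj oB Bv))).
pose m := Num.min (e / 2) (`|v| / 2).
have m0 : 0 < m by rewrite lt_min !divr_gt0 ?normr_gt0.
exists m => // w; rewrite le_min => /andP[we wv].
have vw0 : v + w != 0.
  rewrite addr_eq0; apply/eqP => vE.
  have : `|v| = `|w| by rewrite vE normrN.
  by have : 0 < `|v| by [rewrite normr_gt0]; lra.
split => // q qvw.
have : B (val (nzvec_of vw0)).
  by apply: He; rewrite -ball_normE/= opprD addNKr normrN; lra.
rewrite -[B _]/((val @^-1` B) _) BU/=.
by rewrite -(represents_inj qvw (represents_pi (nzvec_of vw0))).
Qed.

Lemma closure_represents (A : set P) p v e : closure A p -> represents p v -> 0 < e ->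
  exists w q, [/\ `|w| < e, A q & represents q (v + w)].
Proof.
move=> clA pv e0.
pose U : set P := [set q | exists2 w, `|w| < e & represents q (v + w)].
have Up : U p by exists 0; rewrite ?normr0// addr0.
have oU : open U.
  (* The preimage of [U] in the nonzero vectors is the union of all nonzero rescalings of the
     ball. *)
  pose B : set 'cV[R]_d := \bigcup_(a in [set a : R | a != 0]) ((fun u => a *: u) @^-1` ball v e).
  exists B.
    apply: bigcup_open => a _; apply: open_comp; last exact: ball_open.
    by move=> u _; apply: scaler_continuous.
  apply/seteqP; split => u /=.
    move=> [a a0 /=]; rewrite -ball_normE/= => h.
    exists (a *: val u - v); first by rewrite distrC.
    by rewrite addrC subrK; apply: representsZ => //; exact: represents_pi.
  move=> [w we uw]; have [a a0 E] := represents_collinear (represents_pi u) uw.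
  by exists a => //=; rewrite -ball_normE/= -E opprD addNKr normrN.
have [q [Aq [w we qw]]] := clA U (open_nbhs_nbhs (conj oU Up)).
by exists w, q.
Qed.

Lemma represents_closure (A : set P) p v : represents p v ->
  (forall e, 0 < e -> exists w q, [/\ `|w| <= e, A q & represents q (v + w)]) ->
  closure A p.
Proof.
move=> pv H U; rewrite nbhsE => -[V [oV Vp] VU].
have [e e0 He] := open_represents oV Vp pv.
have [w [q [we Aq qw]]] := H _ e0; exists q; split => //.
by apply: VU; apply: (He w we).2.
Qed.

End Represents.

(** * The cone over a convex domain *)

Section OmegaCone.
Variables (R : realType) (d : nat) (Omega : set (pspace R d)).
Local Notation P := (pspace R d).
Implicit Types (p q : P) (v w : 'cV[R]_d) (f : 'rV[R]_d).

Definition omega_cone f : set 'cV[R]_d :=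
  [set v | exists p, [/\ Omega p, represents p v & 0 < form f v]].

Variable f : 'rV[R]_d.
Hypotheses (oO : open Omega) (Of : closure Omega `<=` chart f).
Hypothesis cvxO : convex_in_chart f Omega.
Local Notation C := (omega_cone f).
Local Notation K := (closed_hull C).

Lemma Omega_chart p : Omega p -> chart f p.
Proof. by move=> Op; apply: Of; exact: subset_closure. Qed.

Lemma omega_coneP v p : represents p v -> C v <-> Omega p /\ 0 < form f v.
Proof.
move=> pv; split=> [[q [Oq qv fv]]|[Op fv]]; last by exists p.
by rewrite (represents_inj pv qv).
Qed.

Lemma omega_cone_chart p : Omega p -> C (chart_coord f p).
Proof.
move=> Op; have fp := Omega_chart Op; exists p; split => //.
  exact: represents_chart.
by rewrite form_chart_coord.
Qed.

Lemma omega_cone_or p v : Omega p -> represents p v -> C v \/ C (- v).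
Proof.
move=> Op pv; have := represents_form pv (Omega_chart Op).
rewrite neq_lt => /orP[fv|fv]; [right|left]; exists p; split => //.
  by rewrite -scaleN1r; apply: representsZ; rewrite ?oppr_eq0 ?oner_eq0.
by rewrite formN oppr_gt0.
Qed.

Lemma omega_cone_open_cone : open_cone C.
Proof.
split.
- move=> v w [p [Op pv fv]] [q [Oq qw fw]].
  (* In the chart, the point of [v + w] is the barycentre of the points of [v] and [w] with weights
     [a] and [b]. *)
  pose a := form f v; pose b := form f w.
  have ab : 0 < a + b by exact: addr_gt0.
  have t0 : 0 <= a / (a + b) by rewrite divr_ge0 ?ltW.
  have t1 : a / (a + b) <= 1 by rewrite ler_pdivrMr// mul1r lerDl ltW.
  have := @cvxO (chart_coord f p) (chart_coord f q) (Itv01 t0 t1).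
  rewrite !inE => /(_ (ex_intro2 _ _ p Op erefl) (ex_intro2 _ _ q Oq erefl)).
  move=> [z Oz zE].
  have {}zE : chart_coord f z =
    a / (a + b) *: chart_coord f p + (1 - a / (a + b)) *: chart_coord f q by exact: zE.
  rewrite (chart_coordE f pv) (chart_coordE f qw) -/a -/b in zE.
  exists z; rewrite formD; split => //.
  have -> : v + w = (a + b) *: chart_coord f z.
    rewrite zE; vec; field.
    by rewrite !lt0r_neq0.
  by apply: representsZ; [exact: lt0r_neq0|exact/represents_chart/Omega_chart].
- move=> t v t0 [p [Op pv fv]]; exists p; split => //.
    by apply: representsZ => //; exact: lt0r_neq0.
  by rewrite formZ mulr_gt0.
- move=> v [p [Op pv fv]]; have [e e0 He] := open_represents oO Op pv.
  pose s := \sum_j `|f 0 j|.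
  have s0 : 0 <= s by apply: sumr_ge0.
  have s1 : 0 < 2 * (s + 1) by rewrite mulr_gt0// ltr_wpDl.
  exists (Num.min e (form f v / (2 * (s + 1)))).
    by rewrite lt_min e0 divr_gt0.
  move=> w; rewrite le_min => /andP[/He[vw0 Hw]] ws.
  have [q qvw] := represents_ex vw0; exists q; split => //; first exact: Hw.
  rewrite formD; have := form_le_norm f (- w); rewrite formN normrN -/s => h.
  move: ws; rewrite ler_pdivlMr// => ws.
  have := normr_ge0 w; nra.
- by move=> [p [_ /represents_neq0]]; rewrite eqxx.
Qed.

Let CC := omega_cone_open_cone.

(** The Hilbert distance and the rays come with charts of their own, not with the chart [f] that
    defines the cone; the two agree on the cone up to this choice of sign. *)
Lemma chart_sign g : Omega !=set0 -> closure Omega `<=` chart g -> exists2 s : R,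
  s != 0 & forall v, C v -> 0 < form (s *: g) v.
Proof.
move=> [p Op] Og.
have Cne : C !=set0 by exists (chart_coord f p); exact: omega_cone_chart.
have g0 w : C w -> form g w != 0.
  by move=> [q [Oq qw _]]; apply: (represents_form qw); apply: Og; exact: subset_closure.
have [s s0 sC] := form_sign CC Cne g0.
exists s => // v /sC sv.
by rewrite /form -scalemxAl mxE.
Qed.

Lemma closure_hull p v : Omega !=set0 -> closure Omega p -> represents p v ->
  0 < form f v -> K v.
Proof.
move=> O0 clp pv fv x Cx; have [e e0 He] := cone_open CC Cx.
pose s := \sum_j `|f 0 j|; have s0 : 0 <= s by apply: sumr_ge0.
have s1 : 0 < 2 * (s + 1) by rewrite mulr_gt0// ltr_wpDl.
pose e' := Num.min e (form f v / (2 * (s + 1))).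
have e'0 : 0 < e' by rewrite lt_min e0 divr_gt0.
have [w [q [we Oq qvw]]] := closure_represents clp pv e'0.
move: we; rewrite lt_min => /andP[we].
rewrite ltr_pdivlMr// => ws.
rewrite (_ : x + v = (x - w) + (v + w)); last by vec; ring.
apply: coneD => //; first by apply: He; rewrite normrN ltW.
apply/(omega_coneP qvw); split => //.
rewrite formD; have := form_le_norm f (- w); rewrite formN normrN -/s => h.
have := normr_ge0 w; nra.
Qed.

Lemma hull_closure p v : Omega !=set0 -> K v -> represents p v -> closure Omega p.
Proof.
move=> [q Oq] Kv pv; have Cx := omega_cone_chart Oq; set x := chart_coord f q in Cx.
apply: (represents_closure pv) => e e0; pose t := e / (1 + `|x|).
have x1 : 0 < 1 + `|x| by rewrite ltr_pwDl.
have t0 : 0 < t by exact: divr_gt0.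
have [z [Oz zr _]] := Kv _ (coneZ CC t0 Cx).
exists (t *: x), z; split => //; last by rewrite addrC.
by rewrite normrZ gtr0_norm// /t mulrAC ler_pdivrMr// ler_pM2l// lerDr.
Qed.

End OmegaCone.

(** * The Hilbert metric *)

Definition chord (R : realType) (d : nat) (C : set 'cV[R]_d) (A B : 'cV[R]_d) : Prop :=
  [/\ closed_hull C A, closed_hull C B, ~ C A, ~ C B & C (A + B)].

Section Chord.
Variables (R : realType) (d : nat) (C : set 'cV[R]_d) (CC : open_cone C).
Local Notation K := (closed_hull C).
Implicit Types (x y A B : 'cV[R]_d).

Lemma chord_comb A B i j : chord C A B -> 0 < i -> 0 < j -> C (i *: A + j *: B).
Proof.
move=> [KA KB _ _ CAB] i0 j0; pose m := Num.min i j.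
have -> : i *: A + j *: B = m *: (A + B) + ((i - m) *: A + (j - m) *: B) by vec; ring.
apply: hullD; [apply: hullZ|apply: hullZ|apply: coneZ] => //.
- by rewrite subr_ge0 ge_min lexx.
- by rewrite subr_ge0 ge_min lexx orbT.
- by rewrite lt_min i0.
Qed.

(** A supporting form at either end reads off the coefficient of the other end, up to a positive
    factor. *)
Lemma chord_comb_gt0 A B i j : chord C A B -> C (i *: A + j *: B) -> 0 < i /\ 0 < j.
Proof.
move=> [KA KB nCA nCB CAB] Cij; have Cne : C !=set0 by exists (A + B).
have [al [al0 alA]] := supporting_form CC Cne KA nCA.
have [be [be0 beB]] := supporting_form CC Cne KB nCB.
have alB : 0 < form al B by have := al0 _ CAB; rewrite formD alA add0r.
have beA : 0 < form be A by have := be0 _ CAB; rewrite formD beB addr0.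
have := al0 _ Cij; have := be0 _ Cij; rewrite !formE alA beB !mulr0 addr0 add0r.
by rewrite !pmulr_lgt0.
Qed.

Lemma chord_near A B th r : chord C A B -> 0 < th -> th <= 1 ->
  cone_near C r (A + B) (th *: A + B) <-> 1 < expR (2 * r) * th.
Proof.
move=> ch th0 th1; split=> [[a [b [a0 b0 ab Ca Cb]]]|].
  have /(chord_comb_gt0 ch)[ath _] : C ((a * th - 1) *: A + (a - 1) *: B).
    by move: Ca; congr C; vec; ring.
  have /(chord_comb_gt0 ch)[_ b1] : C ((b - th) *: A + (b - 1) *: B).
    by move: Cb; congr C; vec; ring.
  have h : a * b * th < expR (2 * r) * th by rewrite ltr_pM2r.
  by apply: lt_trans h; nra.
(* [1 < m] makes the two memberships in the open cone strict, and [m * m < E] keeps the product of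
   the factors [m / th] and [m] below [expR (2 * r)]. *)
set E := _ * th => E1; pose m := 1 + Num.min 1 ((E - 1) / 4).
have m1 : 1 < m by rewrite ltrDl lt_min ltr01 divr_gt0// subr_gt0.
have mE : m * m < E.
  rewrite /m; set t := Num.min _ _.
  have [t1 t2] : t <= 1 /\ t <= (E - 1) / 4 by rewrite !ge_min lexx/= lexx orbT.
  have t0 : 0 < t by move: m1; rewrite /m ltrDl.
  by nra.
exists (m / th), m; split.
- by rewrite divr_gt0//; lra.
- by lra.
- by rewrite mulrAC ltr_pdivrMr.
- have -> : (m / th) *: (th *: A + B) - (A + B) = (m - 1) *: A + (m / th - 1) *: B.
    by vec; field; exact: lt0r_neq0.
  apply: chord_comb => //; rewrite subr_gt0// ltr_pdivlMr// mul1r.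
  exact: le_lt_trans m1.
- have -> : m *: (A + B) - (th *: A + B) = (m - th) *: A + (m - 1) *: B by vec; ring.
  by apply: chord_comb => //; rewrite subr_gt0//; apply: le_lt_trans m1.
Qed.

Lemma cone_near_sym r x y : cone_near C r x y -> cone_near C r y x.
Proof. by move=> [a [b [a0 b0 ab Ca Cb]]]; exists b, a; split=> //; rewrite mulrC. Qed.

Lemma cone_near_trans r s x y z :
  cone_near C r x y -> cone_near C s y z -> cone_near C (r + s) x z.
Proof.
move=> [a [b [a0 b0 ab Ca Cb]]] [a' [b' [a'0 b'0 ab' Ca' Cb']]].
exists (a * a'), (b * b'); split; rewrite ?mulr_gt0//.
- rewrite mulrACA mulrDr expRD; apply: ltr_pM => //; rewrite mulr_ge0 ?ltW//.
- have -> : (a * a') *: z - x = a *: (a' *: z - y) + (a *: y - x) by vec; ring.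
  by apply: coneD => //; exact: coneZ.
- have -> : (b * b') *: x - z = b' *: (b *: x - y) + (b' *: y - z) by vec; ring.
  by apply: coneD => //; exact: coneZ.
Qed.

Lemma cone_near_refl r x : C x -> cone_near C r x x <-> 0 < r.
Proof.
move=> Cx; have comb a : C (a *: x - x) <-> 1 < a.
  rewrite -{2}[x]scale1r -scalerBl; split=> [Ca|a1]; last by apply: coneZ; rewrite ?subr_gt0.
  rewrite ltNge; apply/negP => a1.
  apply: (cone0 CC); rewrite -(subrr ((a - 1) *: x)) -scaleNr.
  apply: hullZ => //; first by lra.
  exact: cone_hull.
split=> [[a [b [a0 b0 ab /comb a1 /comb b1]]]|r0].
  have : expR 0 < expR (2 * r) by rewrite expR0; apply: lt_trans ab; nra.
  by rewrite ltr_expR; lra.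
have e1 : 1 < expR (r / 2) by rewrite -[ltLHS]expR0 ltr_expR divr_gt0.
exists (expR (r / 2)), (expR (r / 2)); split; rewrite ?expR_gt0//; try exact/comb.
by rewrite -expRD ltr_expR; lra.
Qed.

Variables (f : 'rV[R]_d) (k : R).
Hypothesis k0 : 0 < k.
Hypothesis Ck : forall x, C x -> `|x| <= k * form f x.

(** Take the supremum of the parameters that stay in [C]: it is finite because the slice
    [form f = 1] of [C] is bounded, and it is not attained because [C] is open. *)
Lemma chord_extend x y : C x -> C y -> form f x = 1 -> form f y = 1 -> x != y ->
  exists2 t, 1 < t & K (x + t *: (y - x)) /\ ~ C (x + t *: (y - x)).
Proof.
move=> Cx Cy fx fy xy; pose z t := x + t *: (y - x).
have z0 : z 0 = x by rewrite /z scale0r addr0.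
have z1 : z 1 = y by rewrite /z scale1r addrC subrK.
have fz t : form f (z t) = 1 by rewrite !formE fx fy subrr mulr0 addr0.
pose S := [set t | 0 <= t /\ C (z t)].
have yx : 0 < `|y - x| by rewrite normr_gt0 subr_eq0 eq_sym.
have hS : has_sup S.
  split; first by exists 0; split => //; rewrite z0.
  exists ((k + `|x|) / `|y - x|) => t [t0 /Ck]; rewrite fz mulr1 => zk.
  rewrite ler_pdivlMr// -[X in X * _](ger0_norm t0) -normrZ.
  have -> : t *: (y - x) = z t - x by rewrite /z addrAC subrr add0r.
  by apply: le_trans (ler_normB _ _) _; rewrite lerD2r.
have Sopen t : S t -> exists2 e, 0 < e & S (t + e).
  move=> [t0 Ct]; have [e e0 He] := cone_openZ CC (y - x) Ct.
  exists e => //; split; first by rewrite addr_ge0// ltW.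
  have -> : z (t + e) = z t + e *: (y - x) by rewrite /z scalerDl addrA.
  by apply: He; rewrite gtr0_norm.
have S1 : S 1 by split; rewrite ?z1.
set T := sup S.
have T1 : 1 < T.
  by have [e e0 Se] := Sopen _ S1; have := sup_upper_bound hS Se; rewrite -/T; lra.
exists T => //; split; last first.
  move=> CT; have [|e e0 Se] := Sopen T; first by split => //; lra.
  by have := sup_upper_bound hS Se; rewrite -/T; lra.
move=> w Cw; have [e e0 He] := cone_openZ CC (y - x) Cw.
have [t [t0 Ct] tT] := sup_adherent e0 hS.
have tT' : t <= T by exact: (sup_upper_bound hS).
rewrite (_ : w + _ = (w + (T - t) *: (y - x)) + z t); last by rewrite /z; vec; ring.
apply: coneD => //; apply: He; rewrite ger0_norm ?subr_ge0//.
by move: tT; rewrite -/T; lra.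
Qed.

End Chord.

(** * The Hilbert distance in terms of cone inequalities *)

Section HilbertDist.
Variables (R : realType) (d : nat) (Omega : set (pspace R d)).
Local Notation P := (pspace R d).
Implicit Types (p q : P) (X Y v w : 'cV[R]_d).
Variables (f : 'rV[R]_d) (k : R).
Hypotheses (oO : open Omega) (Of : closure Omega `<=` chart f).
Hypothesis cvxO : convex_in_chart f Omega.
Hypothesis O0 : Omega !=set0.
Local Notation C := (omega_cone Omega f).
Local Notation K := (closed_hull C).
Hypothesis k0 : 0 < k.
Hypothesis Ck : forall x, C x -> `|x| <= k * form f x.

Let CC := omega_cone_open_cone oO Of cvxO.

Lemma boundaryP p : boundary Omega p <-> closure Omega p /\ ~ Omega p.
Proof. by rewrite /boundary (iffLR (interior_id Omega)). Qed.

Lemma omega_cone_scale X a : a != 0 -> C X -> C (a *: X) -> 0 < a.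
Proof.
move=> a0 CX CaX; rewrite ltNge le_eqVlt (negbTE a0)/=; apply/negP => an.
apply: (coneN CC CaX); rewrite -scaleNr; apply: coneZ => //; lra.
Qed.

Lemma chart_hull g : closure Omega `<=` chart g ->
  exists2 s : R, s != 0 & (forall p, closure Omega p -> K (s *: chart_coord g p)) /\
    (forall p, Omega p -> C (s *: chart_coord g p)).
Proof.
move=> Og; have [s s0 sC] := chart_sign oO Of cvxO O0 Og.
have gE v : form (s *: g) v = s * form g v by rewrite /form -scalemxAl mxE.
have Cne : C !=set0 by have [p Op] := O0; exists (chart_coord f p); exact: omega_cone_chart.
have sK p : closure Omega p -> K (s *: chart_coord g p).
  move=> clp; have fp := Of clp; have gp := Og _ clp.
  have pv := represents_chart fp.
  have Kv : K (chart_coord f p).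
    by apply: (closure_hull oO Of cvxO) clp pv _ => //; rewrite form_chart_coord.
  have := form_hull CC sC Cne Kv; rewrite gE => sg.
  rewrite (chart_coordE g pv) scalerA; apply: hullZ => //.
  rewrite -(pmulr_lge0 _ (_ : 0 < s ^+ 2)) ?exprn_even_gt0//.
  have : form g (chart_coord f p) != 0 by apply: represents_form pv gp.
  move: sg; set u := form g _ => sg u0.
  have -> : s / u * s ^+ 2 = (s / u) ^+ 2 * (s * u) by field.
  by rewrite mulr_ge0 ?sqr_ge0.
exists s => //; split => // p Op.
have gp : chart g p by apply: Og; exact: subset_closure.
have pr := representsZ s0 (represents_chart gp).
have [//|CN] := omega_cone_or Of Op pr.
exfalso; apply: (cone0 CC); rewrite -(addNr (s *: chart_coord g p)).
by apply: sK => //; exact: subset_closure.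
Qed.

Lemma hilbert_chord p q r X Y : p != q -> Omega p -> Omega q ->
  represents p X -> represents q Y -> C X -> C Y -> is_hilbert_dist Omega p q r ->
  exists A B th c c', [/\ chord C A B, 0 < th < 1, r = - (ln th / 2), 0 < c /\ 0 < c' &
     X = c *: (A + B) /\ Y = c' *: (th *: A + B)].
Proof.
move=> pq Op Oq pX qY CX CY [g [a [b [Og /boundaryP[cla na] /boundaryP[clb nb] /=]]]].
have [s s0 [sK sC]] := chart_hull Og.
set a' := chart_coord g a; set b' := chart_coord g b.
set x' := chart_coord g p; set y' := chart_coord g q.
move=> [[u [t [u0 ut t1 xE yE]]] rE].
have gp : chart g p by apply: Og; exact: subset_closure.
have gq : chart g q by apply: Og; exact: subset_closure.
have u1 : u < 1 by exact: lt_trans t1.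
have t0 : 0 < t by exact: lt_trans ut.
have [t_n0 u_n0] : t != 0 /\ u != 0 by split; exact: lt0r_neq0.
have [u_n1 t_n1] : 1 - u != 0 /\ 1 - t != 0 by split; rewrite lt0r_neq0// subr_gt0.
(* Scaled so that [A + B] lies over [p] and, with [th] the inverse of the cross-ratio, [th *: A + B]
   lies over [q]. *)
pose A := ((1 - u) * s) *: a'; pose B := (u * s) *: b'.
pose th := ((1 - t) * u) / ((1 - u) * t).
have nA : ~ C A.
  have aA : represents a A.
    by apply: representsZ; [rewrite mulf_neq0// subr_eq0 gt_eqF|exact: represents_chart (Og _ cla)].
  by move=> /(omega_coneP _ _ aA)[].
have nB : ~ C B.
  have bB : represents b B.
    by apply: representsZ; [rewrite mulf_neq0// lt0r_neq0|exact: represents_chart (Og _ clb)].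
  by move=> /(omega_coneP _ _ bB)[].
have ABE : A + B = s *: x' by rewrite xE /A /B; generalize a' b' => va vb; vec; ring.
have ABE' : th *: A + B = (u / t) *: (s *: y').
  rewrite yE /A /B /th; generalize a' b' => va vb; vec; field.
  by do ?[apply/andP; split].
have nz1 : u / t != 0 by rewrite mulf_neq0 ?invr_eq0 ?lt0r_neq0.
have xr : represents p (s *: x') by apply: representsZ => //; exact: represents_chart.
have yr : represents q (s *: y') by apply: representsZ => //; exact: represents_chart.
have [c c0 XE] := represents_collinear xr pX.
have [c' c'0 YE] := represents_collinear yr qY.
have cpos : 0 < c by apply: omega_cone_scale (sC _ Op) _ => //; rewrite -XE.
have c'pos : 0 < c' by apply: omega_cone_scale (sC _ Oq) _ => //; rewrite -YE.
exists A, B, th, c, (c' * (t / u)); split.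
- split => //.
  + by rewrite /A -scalerA; apply: hullZ; [exact: CC|rewrite subr_ge0 ltW|exact: sK].
  + by rewrite /B -scalerA; apply: hullZ; [exact: CC|exact: ltW|exact: sK].
  + by rewrite ABE; exact: sC.
- rewrite divr_gt0 ?mulr_gt0 ?subr_gt0//= ltr_pdivrMr ?mulr_gt0 ?subr_gt0// mul1r.
  by nra.
- rewrite rE; have ab : 0 < `|b' - a'|.
    rewrite normr_gt0 subr_eq0; apply/eqP => ba; apply: na.
    suff -> : a = p by [].
    apply: (represents_inj (represents_chart (Og _ cla))); rewrite -/a'.
    have -> : a' = x' by rewrite xE ba subrr scaler0 addr0.
    exact: represents_chart.
  have nn w (c1 : R) : 0 <= c1 -> w = c1 *: (b' - a') -> `|w| = c1 * `|b' - a'|.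
    by move=> c10 ->; rewrite normrZ ger0_norm.
  rewrite [`|a' - y'|]distrC [`|a' - x'|]distrC.
  rewrite (nn _ t _ _) ?ltW//; last by rewrite yE addrC addKr.
  rewrite (nn (b' - x') (1 - u)); [|lra|by rewrite xE; vec; ring].
  rewrite (nn (x' - a') u) ?ltW//; last by rewrite xE addrC addKr.
  rewrite (nn (b' - y') (1 - t)); [|lra|by rewrite yE; vec; ring].
  rewrite [X in ln X](_ : _ = th^-1).
    by rewrite lnV ?posrE ?divr_gt0 ?mulr_gt0 ?subr_gt0// mulrN mulrC.
  rewrite /th; field.
  by do ?[apply/andP; split] => //; exact: lt0r_neq0.
- by rewrite mulr_gt0// divr_gt0.
- split; first by rewrite ABE.
  rewrite ABE' YE !scalerA; congr (_ *: _); field.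
  by do ?[apply/andP; split].
Qed.

(** The ends are found by extending the segment in both directions. Existence guarantees that [xget]
    in [hilbert_dist] does not return its default value 0. *)
Lemma hilbert_dist_ex p q : p != q -> Omega p -> Omega q ->
  exists r, is_hilbert_dist Omega p q r.
Proof.
move=> pq Op Oq.
set x := chart_coord f p; set y := chart_coord f q.
have fp := Omega_chart Of Op; have fq := Omega_chart Of Oq.
have xr : represents p x by exact: represents_chart.
have yr : represents q y by exact: represents_chart.
have fx : form f x = 1 by exact: form_chart_coord.
have fy : form f y = 1 by exact: form_chart_coord.
have xy : x != y.
  by apply: contraNneq pq => xy; apply/eqP/(represents_inj xr); rewrite xy.
have Cx : C x by exact: omega_cone_chart.
have Cy : C y by exact: omega_cone_chart.
have [t t1 [KB nB]] := chord_extend CC Ck Cx Cy fx fy xy.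
have [t' t'1 [KA nA]] := chord_extend CC Ck Cy Cx fy fx (contra_neq esym xy).
set B := x + t *: (y - x) in KB nB; set A := y + t' *: (x - y) in KA nA.
have ends v : K v -> ~ C v -> form f v = 1 -> exists2 b, boundary Omega b & chart_coord f b = v.
  move=> Kv nv fv; have v0 : v != 0.
    apply/eqP => v0; move: fv; rewrite v0 /form mulmx0 mxE => /esym/eqP.
    by rewrite oner_eq0.
  have [b bv] := represents_ex v0; exists b.
    apply/boundaryP; split; first by apply: (hull_closure oO Of cvxO O0) bv.
    by move=> Ob; apply: nv; apply/(omega_coneP _ _ bv); rewrite fv.
  by rewrite (chart_coordE f bv) fv invr1 scale1r.
have [|a ba aE] := ends A KA nA; first by rewrite /A formD (formZ f t') formB fx fy subrr mulr0 addr0.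
have [|b bb bE] := ends B KB nB; first by rewrite /B formD (formZ f t) formB fx fy subrr mulr0 addr0.
eexists; exists f, a, b; split => //=; split; last reflexivity.
rewrite aE bE -/x -/y; exists ((t' - 1) / (t + t' - 1)), (t' / (t + t' - 1)).
have tt : 0 < t + t' - 1 by lra.
split.
- by rewrite divr_gt0// subr_gt0.
- by rewrite ltr_pM2r ?invr_gt0//; lra.
- by rewrite ltr_pdivrMr//; lra.
- by rewrite /A /B; generalize x y => vx vy; vec; field; exact: lt0r_neq0.
- by rewrite /A /B; generalize x y => vx vy; vec; field; exact: lt0r_neq0.
Qed.

Lemma hilbert_distP p q : p != q -> Omega p -> Omega q ->
  is_hilbert_dist Omega p q (hilbert_dist Omega p q).
Proof.
move=> pq Op Oq; rewrite /hilbert_dist (negbTE pq); apply: xgetPex.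
exact: hilbert_dist_ex.
Qed.

(** Translates the metric into linear inequalities: up to positive scalars, distinct points are
    [A + B] and [th *: A + B] on a chord, where [chord_near] decides. *)
Lemma hilbert_dist_near p q r X Y : represents p X -> represents q Y -> C X -> C Y ->
  hilbert_dist Omega p q < r <-> cone_near C r X Y.
Proof.
move=> pX qY CX CY.
have [Op _] := iffLR (omega_coneP _ _ pX) CX.
have [Oq _] := iffLR (omega_coneP _ _ qY) CY.
have [pq|pq] := eqVneq p q.
  rewrite -pq in qY *; have [c c0 YE] := represents_collinear pX qY.
  have cpos : 0 < c by apply: (omega_cone_scale c0 CX); rewrite -YE.
  rewrite /hilbert_dist eqxx -(cone_near_refl CC r CX); split=> H.
    apply: (cone_nearZ (a := 1) (b := c^-1) CC) => //; rewrite ?invr_gt0//.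
    by rewrite scale1r YE scalerA mulVf// scale1r.
  by apply: (cone_nearZ (a := 1) (b := c) CC) => //; rewrite scale1r -YE.
have [A [B [th [c [c' [ch /andP[th0 th1] rE [c0 c'0] [-> ->]]]]]]] :=
  hilbert_chord pq Op Oq pX qY CX CY (hilbert_distP pq Op Oq).
rewrite rE; have -> : (- (ln th / 2) < r) <-> (1 < expR (2 * r) * th).
  rewrite -{2}(lnK (_ : th \in Num.pos)) ?posrE// -expRD -[X in _ <-> X < _]expR0.
  by rewrite ltr_expR; split=> ?; lra.
rewrite -(chord_near CC r ch th0 (ltW th1)); split=> H.
  apply: (cone_nearZ (a := c^-1) (b := c'^-1) CC); rewrite ?invr_gt0//.
  by rewrite !scalerA !mulVf ?lt0r_neq0// !scale1r.
exact: (cone_nearZ (a := c) (b := c') CC).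
Qed.

End HilbertDist.

(** * Rays *)

(** [h *: A + B] is the point at signed distance [- ln h / 2] from [A + B] on
    the chord; [l] stands for the vectors over a ray. *)
Definition chord_segment (R : realType) (d : nat) (C : set 'cV[R]_d) (th : R)
    (l : set 'cV[R]_d) (A B : 'cV[R]_d) : Prop :=
  [/\ chord C A B,
      forall z, l z -> exists c h, [/\ 0 < c, 0 < h & z = c *: (h *: A + B)] &
      forall h, th <= h <= 1 -> l (h *: A + B)].

(** * Transport by matrices preserving the cone *)

Section Transport.
Variables (R : realType) (d : nat) (C : set 'cV[R]_d) (CC : open_cone C).
Variables (g g' : 'M[R]_d).
Hypotheses (gC : forall x, C x -> C (g *m x)) (g'C : forall x, C x -> C (g' *m x)).
Hypotheses (gg' : g *m g' = 1%:M) (g'g : g' *m g = 1%:M).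
Local Notation K := (closed_hull C).

Lemma cone_mapE x : C (g *m x) <-> C x.
Proof. by split=> [/g'C|/gC//]; rewrite mulmxA g'g mul1mx. Qed.

Lemma hull_map x : K x -> K (g *m x).
Proof.
move=> Kx y Cy; rewrite -[y]mul1mx -gg' -mulmxA -mulmxDr; apply/cone_mapE.
exact/Kx/g'C.
Qed.

Lemma cone_near_map r x y : cone_near C r x y -> cone_near C r (g *m x) (g *m y).
Proof.
move=> [a [b [a0 b0 ab Ca Cb]]]; exists a, b; split => //.
  by rewrite scalemxAr -mulmxBr; exact: gC.
by rewrite scalemxAr -mulmxBr; exact: gC.
Qed.

Lemma chord_map A B : chord C A B -> chord C (g *m A) (g *m B).
Proof.
move=> [KA KB nA nB CAB]; split; rewrite ?cone_mapE//; try exact: hull_map.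
by rewrite -mulmxDr; exact: gC.
Qed.

End Transport.

Section TransportMorse.
Variables (R : realType) (d : nat) (C : set 'cV[R]_d) (CC : open_cone C).
Variables (g g' : 'M[R]_d).
Hypotheses (gC : forall x, C x -> C (g *m x)) (g'C : forall x, C x -> C (g' *m x)).
Hypotheses (gg' : g *m g' = 1%:M) (g'g : g' *m g = 1%:M).

Lemma cone_morse_map D l : cone_morse C D l -> cone_morse C D [set g *m z | z in l].
Proof.
move=> Ml T q T0 Cq up low [z0 lz0 q0] [zT lzT qT] t tI.
have qg u : q u = g *m (g' *m q u) by rewrite mulmxA gg' mul1mx.
have back r x y : cone_near C r (g *m x) (g *m y) -> cone_near C r x y.
  by move=> /(cone_near_map g'C); rewrite !mulmxA g'g !mul1mx.
have [| | | | |z lz nz] := Ml T (fun u => g' *m q u) T0 _ _ _ _ _ t tI.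
- by move=> u uI; apply/g'C/Cq.
- by move=> u v uI vI; exact/(cone_near_map g'C)/up.
- move=> u v r uI vI; move=> nuv; apply: low uI vI _.
  by rewrite (qg u) (qg v); exact: cone_near_map.
- by rewrite -q0 mulmxA g'g mul1mx.
- by rewrite -qT mulmxA g'g mul1mx.
exists (g *m z); first by exists z.
by rewrite (qg t); exact: cone_near_map.
Qed.

Lemma chord_segment_map th l A B : chord_segment C th l A B ->
  chord_segment C th [set g *m z | z in l] (g *m A) (g *m B).
Proof.
move=> [ch line seg]; split; first exact: (chord_map gC g'C).
  move=> _ [z /line[c [h [c0 h0 ->]]] <-]; exists c, h; split => //.
  by rewrite -scalemxAr mulmxDr -scalemxAr.
by move=> h /seg lh; exists (h *: A + B) => //; rewrite mulmxDr -scalemxAr.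
Qed.

(** Absorbing [th] into [A] turns the far end into the sum [B + th *: A], from which heights are
    measured on the reversed segment; height [h] there is height [th / h] before. *)
Lemma chord_segment_swap th l A B : 0 < th ->
  (forall z a, 0 < a -> l z -> l (a *: z)) ->
  chord_segment C th l A B -> chord_segment C th l B (th *: A).
Proof.
move=> th0 lZ [ch line seg]; split.
- case: (ch) => KA KB nA nB CAB; split => //; first exact: hullZ (ltW th0) KA.
    by move=> /(coneZ_inv CC th0).
  by rewrite addrC -[B]scale1r; exact: chord_comb.
- move=> z /line[c [h [c0 h0 ->]]]; exists (c * h / th), (th / h).
  split; rewrite ?divr_gt0 ?mulr_gt0//; vec; field.
  by rewrite !lt0r_neq0.
- move=> h /andP[h1 h2]; have h0 : 0 < h by exact: lt_le_trans h1.
  have -> : h *: B + th *: A = h *: ((th / h) *: A + B) by vec; field; exact: lt0r_neq0.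
  apply/lZ/seg => //; rewrite ler_pdivlMr// ler_pdivrMr// mul1r h1 andbT.
  by rewrite ger_pMr.
Qed.

End TransportMorse.

(** The added 1 turns the weak inequality of [morse] into the strict one of [cone_near]. *)
Definition morse_radius (R : realType) (M : morse_gauge R) : R :=
  (M (2 : R)%:nng (2 : R)%:nng)%:num + 1.

Section Ray.
Variables (R : realType) (d : nat) (Omega : set (pspace R d)).
Local Notation P := (pspace R d).
Implicit Types (p q : P) (X Y v w : 'cV[R]_d).
Variables (f : 'rV[R]_d) (k : R).
Hypotheses (oO : open Omega) (Of : closure Omega `<=` chart f).
Hypothesis cvxO : convex_in_chart f Omega.
Hypothesis O0 : Omega !=set0.
Local Notation C := (omega_cone Omega f).
Local Notation K := (closed_hull C).
Hypothesis k0 : 0 < k.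
Hypothesis Ck : forall x, C x -> `|x| <= k * form f x.

Let CC := omega_cone_open_cone oO Of cvxO.

Variable c : R -> P.
Hypothesis rc : projective_geodesic_ray Omega c.

Definition ray_cone : set 'cV[R]_d :=
  [set v | C v /\ exists2 p, ray_image c p & represents p v].

Lemma ray_coneZ z a : 0 < a -> ray_cone z -> ray_cone (a *: z).
Proof.
move=> a0 [Cz [p cp pz]]; split; first exact: coneZ.
by exists p => //; apply: representsZ => //; exact: lt0r_neq0.
Qed.

Lemma ray_Omega p : ray_image c p -> Omega p.
Proof. by case: rc => -[cO _] _ [t t0 <-]; exact: cO. Qed.

Lemma ray_chord s t X Y : 0 <= s -> 0 <= t -> s != t ->
  represents (c s) X -> represents (c t) Y -> C X -> C Y ->
  exists A B c1 c2, [/\ chord_segment C (expR (- (2 * `|s - t|))) ray_cone A B,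
    0 < c1, 0 < c2, X = c1 *: (A + B) &
    Y = c2 *: (expR (- (2 * `|s - t|)) *: A + B)].
Proof.
move=> s0 t0 st sX tY CX CY.
case: rc => -[cO geo] [g [x [y [Og Ox bdy img]]]].
have dst := geo _ _ s0 t0.
have cst : c s != c t.
  apply: contraNneq st => cst; move: dst; rewrite cst /hilbert_dist eqxx => /esym/eqP.
  by rewrite normr_eq0 subr_eq0.
have [Os Ot] : Omega (c s) /\ Omega (c t) by split; exact: cO.
have [A [B [th [c1 [c2 [ch /andP[th0 th1] rE [c10 c20] [XE YE]]]]]]] :=
  hilbert_chord oO Of cvxO O0 cst Os Ot sX tY CX CY
    (hilbert_distP oO Of cvxO O0 Ck cst Os Ot).
have -> : expR (- (2 * `|s - t|)) = th.
  rewrite -dst rE -[RHS]lnK ?posrE//; congr expR; lra.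
have [e e0 [eK eC]] := chart_hull oO Of cvxO O0 Og.
set x' := chart_coord g x in img; set y' := chart_coord g y in img.
have gO p : Omega p -> chart g p by move=> Op; apply: Og; exact: subset_closure.
have onray p : ray_image c p -> exists2 u, 0 <= u < 1 &
    chart_coord g p = (1 - u) *: x' + u *: y'.
  move=> cp; have : (chart_coord g @` ray_image c) (chart_coord g p) by exists p.
  by rewrite img => -[u uI uE]; exists u.
have rayrep p v : ray_image c p -> represents p v -> exists u a,
    [/\ a != 0, 0 <= u < 1 & v = a *: ((1 - u) *: x' + u *: y')].
  move=> cp pv; have [u uI uE] := onray p cp.
  have [a a0 vE] := represents_collinear (represents_chart (gO _ (ray_Omega cp))) pv.
  by exists u, a; rewrite -uE.
have cs : ray_image c (c s) by exists s.
have ct : ray_image c (c t) by exists t.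
have [u1 [a1 [a10 u1I X1]]] := rayrep _ _ cs sX.
have [u2 [a2 [a20 u2I Y2]]] := rayrep _ _ ct tY.
have sgn p v u a : Omega p -> represents p v -> C v ->
    a != 0 -> v = a *: ((1 - u) *: x' + u *: y') ->
    chart_coord g p = (1 - u) *: x' + u *: y' -> 0 < a / e.
  move=> Op pv Cv a0 vE pE; apply: (omega_cone_scale oO Of cvxO _ (eC _ Op)).
    by rewrite mulf_neq0 ?invr_eq0.
  by rewrite scalerA divfK// pE -vE.
exists A, B, c1, c2; split => //; split => //.
- move=> z [Cz [p cp pz]]; have [u3 [a3 [a30 u3I Z3]]] := rayrep _ _ cp pz.
  have u12 : u1 != u2.
    apply: contraNneq cst => u12; apply/eqP/(represents_inj sX).
    rewrite X1 u12; have -> : a1 *: ((1 - u2) *: x' + u2 *: y') = (a1 / a2) *: Y.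
      by rewrite Y2 scalerA divfK.
    by apply: representsZ => //; rewrite mulf_neq0 ?invr_eq0.
  have u21 : u2 - u1 != 0 by rewrite subr_eq0 eq_sym.
  (* Affine position of the third ray point relative to the first two. It expresses [z] through [X]
     and [Y], hence through [A] and [B]; the coefficients are positive since [z] is in [C]. *)
  pose m := (u3 - u1) / (u2 - u1).
  pose i := a3 * ((1 - m) / a1 * c1 + m / a2 * c2 * th).
  pose j := a3 * ((1 - m) / a1 * c1 + m / a2 * c2).
  have zE : z = i *: A + j *: B.
    have -> : z = (a3 * (1 - m) / a1) *: X + (a3 * m / a2) *: Y.
      rewrite Z3 X1 Y2 /m; generalize x' y' => vx vy; vec; field.
      by do ?[apply/andP; split].
    by rewrite XE YE /i /j; vec; ring.
  have [i0 j0] : 0 < i /\ 0 < j by apply: (chord_comb_gt0 CC ch); rewrite -zE.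
  exists j, (i / j); rewrite divr_gt0//; split => //.
  by rewrite zE; vec; field; exact: lt0r_neq0.
- move=> h /andP[h1 h2].
  have th1' : 0 < 1 - th by rewrite subr_gt0.
  have [uu1 uu1I uu1E] := onray _ cs; have [uu2 uu2I uu2E] := onray _ ct.
  have [b1 b10 X1'] := represents_collinear (represents_chart (gO _ Os)) sX.
  have [b2 b20 Y2'] := represents_collinear (represents_chart (gO _ Ot)) tY.
  rewrite uu1E in X1'; rewrite uu2E in Y2'.
  have b1e := sgn _ _ _ _ Os sX CX b10 X1' uu1E.
  have b2e := sgn _ _ _ _ Ot tY CY b20 Y2' uu2E.
  (* Position of the height [h] between the heights [th] of [Y] and 1 of [X]. The weights [m1] and
     [m2] carry it over to the chart [g], where the image of the ray is convex. *)
  pose v := (h - th) / (1 - th).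
  have v0 : 0 <= v by apply: divr_ge0; [rewrite subr_ge0|exact: ltW].
  have v1 : v <= 1 by rewrite ler_pdivrMr// mul1r lerD2r.
  pose m1 := v * (b1 / e) / c1; pose m2 := (1 - v) * (b2 / e) / c2.
  have m10 : 0 <= m1 by apply: divr_ge0 (ltW c10); exact: mulr_ge0 (ltW b1e).
  have m20 : 0 <= m2.
    by apply: divr_ge0 (ltW c20); apply: mulr_ge0 (ltW b2e); rewrite subr_ge0.
  have m12 : 0 < m1 + m2.
    have [v_0|v_n0] := eqVneq v 0.
      by rewrite ltr_wpDl// /m2 v_0 subr0 mul1r divr_gt0.
    rewrite ltr_pwDl// /m1; apply: divr_gt0 => //; apply: mulr_gt0 => //.
    by rewrite lt_neqAle eq_sym v_n0.
  have ZE : h *: A + B = (e * (m1 + m2)) *: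
      ((1 - (m1 * uu1 + m2 * uu2) / (m1 + m2)) *: x' + ((m1 * uu1 + m2 * uu2) / (m1 + m2)) *: y').
    have -> : h *: A + B = (v / c1) *: X + ((1 - v) / c2) *: Y.
      rewrite XE YE /v; vec; field.
      by do ?[apply/andP; split] => //; exact: lt0r_neq0.
    have -> : (v / c1) *: X + ((1 - v) / c2) *: Y = (e * m1) *: ((1 - uu1) *: x' + uu1 *: y') +
        (e * m2) *: ((1 - uu2) *: x' + uu2 *: y').
      rewrite X1' Y2' /m1 /m2; generalize x' y' => vx vy; vec; field.
      by do ?[apply/andP; split] => //; exact: lt0r_neq0.
    have := lt0r_neq0 m12; generalize m1 m2 x' y' => n1 n2 vx vy n12.
    by vec; field.
  split; first by rewrite -[B]scale1r; apply: (chord_comb CC ch) => //; exact: lt_le_trans h1.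
  set uu := (_ / _) in ZE.
  have [p cp pE] : (chart_coord g @` ray_image c) ((1 - uu) *: x' + uu *: y').
    rewrite img; exists uu => //=; move: uu1I uu2I => /andP[? ?] /andP[? ?].
    apply/andP; split.
      by apply: divr_ge0 (ltW m12); apply: addr_ge0; exact: mulr_ge0.
    rewrite ltr_pdivrMr// mul1r.
    have [uu1_1 uu2_1] : 0 < 1 - uu1 /\ 0 < 1 - uu2 by rewrite !subr_gt0.
    move: m10 m20 m12 uu1_1 uu2_1; generalize m1 m2 uu1 uu2.
    move=> n1 n2 w1 w2 n10 n20 n12 w1p w2p.
    have [n1_0|n1_n0] := eqVneq n1 0; first by rewrite n1_0 !mul0r !add0r in n12 *; nra.
    have {n1_n0} : 0 < n1 by rewrite lt_neqAle eq_sym n1_n0.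
    by move=> n1p; have : 0 < n1 * (1 - w1) by [exact: mulr_gt0]; nra.
  exists p => //; rewrite ZE -pE; apply: representsZ.
    by rewrite mulf_neq0// lt0r_neq0.
  exact/represents_chart/gO/ray_Omega.
Qed.

Lemma morse_ray_cone (M : morse_gauge R) : morse Omega M (ray_image c) ->
  cone_morse C (morse_radius M) ray_cone.
Proof.
move=> MO T q T0 Cq up low [_ [p0 cp0 q0]] [_ [pT cpT qT]] t tI.
(* Projective point of [q u]; the default [c 0] can only occur outside the interval. *)
pose qq u := xget (c 0) [set p | represents p (q u)].
have qqE u : 0 <= u <= T -> represents (qq u) (q u).
  move=> uI; have [p pu] := represents_ex (represents_neq0 (represents_hvec (qq u))).
  have [p' [_ pr _]] := Cq _ uI.
  by apply: (@xgetPex _ _ [set p | represents p (q u)]); exists p'.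
have near (u v r : R) : 0 <= u <= T -> 0 <= v <= T ->
    hilbert_dist Omega (qq u) (qq v) < r <-> cone_near C r (q u) (q v).
  by move=> uI vI; apply: (hilbert_dist_near oO Of cvxO O0 Ck); auto.
have [||||p cp dp] := MO (2 : R)%:nng (2 : R)%:nng 0 T qq _ T0 _ _ _ t tI.
- by rewrite /=; lra.
- split.
    move=> u uI; have [p' [Op' pr _]] := Cq _ uI.
    by rewrite (represents_inj (qqE _ uI) pr).
  move=> u v uI vI /=; have nr r := near u v r uI vI; apply/andP; split.
    rewrite lerBlDr; apply: (@le_trans _ _ (`|u - v| / 2)); first by rewrite mulrC.
    apply: (@le_trans _ _ (hilbert_dist Omega (qq u) (qq v))); last by rewrite lerDl.
    apply/ler_addgt0Pr => e e0; apply: low uI vI _; apply/nr.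
    by rewrite ltrDl.
  apply: ltW; apply: (@lt_le_trans _ _ (`|u - v| + 2)); first exact/nr/up.
  by rewrite lerD2r ler_peMl//; lra.
- by rewrite (represents_inj (qqE 0 _) q0)// lexx.
- by rewrite (represents_inj (qqE T _) qT)// lexx andbT.
have Op := ray_Omega cp.
exists (chart_coord f p).
  split; first exact: omega_cone_chart.
  by exists p => //; exact/represents_chart/(Omega_chart Of).
apply: (iffLR (hilbert_dist_near oO Of cvxO O0 Ck _ (qqE t tI) _ (Cq t tI) _)).
- exact/represents_chart/(Omega_chart Of).
- exact: omega_cone_chart.
- by apply: le_lt_trans dp _; rewrite ltrDl.
Qed.

End Ray.

(** * Automorphisms *)

Section Gaps.
Variables (R : realType) (d : nat) (C : set 'cV[R]_d) (CC : open_cone C).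
Variables (f : 'rV[R]_d) (k kf : R).
Hypotheses (k0 : 0 < k) (kf0 : 0 < kf).
Hypotheses (Ck : forall x, C x -> `|x| <= k * form f x).
Hypotheses (fk : forall x, form f x <= kf * `|x|).
Variables (x0 : 'cV[R]_d) (e : R).
Hypotheses (e0 : 0 < e) (Cx0 : C x0).
Hypothesis Ce : forall v, `|v| <= e -> C (x0 + v).
Variables (h h' : 'M[R]_d) (a : R).
Hypotheses (hC : forall x, C x -> C (h *m x)) (h'C : forall x, C x -> C (h' *m x)).
Hypotheses (hh' : h *m h' = 1%:M) (h'h : h' *m h = 1%:M) (a0 : a != 0).
Local Notation sv i := ((singular_values (a *: h))`_i).

(** A representative of a class of [PGL] equals the lift preserving the cone only up to a scalar
    [a], which cancels in ratios of singular values. *)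
Lemma scaled_sv_ratio r : (0 < d)%N -> cone_near C r x0 (h *m x0) ->
  sv 0 ^+ 2 <= (d%:R * ((k * kf / e) ^+ 2 * (k * form f x0) ^+ 2 * expR (2 * r))) ^+ 2 *
    sv d.-1 ^+ 2.
Proof.
move=> d0 nr; apply: sv_ratio => //.
  by rewrite mulr_ge0 ?expR_ge0// mulr_ge0 ?sqr_ge0.
move=> v w; have := near_norm CC k0 kf0 Ck fk e0 Cx0 Ce v (h *m w) nr hC h'C h'h.
rewrite mulmxA h'h mul1mx -!scalemxAl !normrZ => H.
have /ler_wpM2l/(_ _ _ H) : 0 <= `|a| by [].
by rewrite !mulrA; congr (_ <= _); ring.
Qed.

Section Thin.
Variables (A B : 'cV[R]_d) (D th r : R) (l : set 'cV[R]_d) (n : nat).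
Hypotheses (d1 : (1 < d)%N) (D0 : 0 < D) (th0 : 0 < th).
Hypothesis (Ml : cone_morse C D l) (lZ : forall z c, 0 < c -> l z -> l (c *: z)).
Hypothesis (AB : chord_segment C th l A B).
Hypotheses (near0 : cone_near C r x0 (A + B)).
Hypotheses (near1 : cone_near C r (h *m x0) (th *: A + B)).
Hypothesis thn : 2 * th <= (expR (- (2 * (2 * D + 1))) / 2) ^+ n.

Let tau := contraction_constant f k kf x0 e r *
  (k * ((1 + expR (- (2 * D + 1)) / 2) ^- n + th)).

Let tau0 : 0 <= tau.
Proof.
have fx0 := form_cone_gt0 CC k0 Ck Cx0.
apply: mulr_ge0; first by rewrite ltW// !mulr_gt0 ?expR_gt0 ?invr_gt0.
by rewrite ltW// mulr_gt0// addr_gt0// invr_gt0 exprn_gt0// addr_gt0//.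
Qed.

Lemma scaled_gap_top : sv 1 ^+ 2 <= d%:R * tau ^+ 2 * sqnorm x0 * sv 0 ^+ 2.
Proof.
case: (AB) => -[KA KB nA nB CAB] line seg.
have [phi phiP] := contraction CC k0 kf0 Ck fk e0 Cx0 Ce KA KB nA nB D0 th0 Ml
  line seg CAB thn near0 near1 hC.
apply: (gap_top (phi := phi)) => // v /phiP H.
by rewrite -!scalemxAl !normrZ mulrCA ler_wpM2l.
Qed.

Lemma scaled_gap_bottom : sv d.-1 ^+ 2 <= d%:R * tau ^+ 2 * sqnorm x0 * sv d.-2 ^+ 2.
Proof.
have AB' := chord_segment_map h'C hC h'h hh' AB.
have l'Z z c : 0 < c -> [set h' *m z | z in l] z -> [set h' *m z | z in l] (c *: z).
  by move=> c0 [y ly <-]; exists (c *: y); rewrite ?scalemxAr//; exact: lZ.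
have [[KA KB nA nB CAB] line seg] := chord_segment_swap CC th0 l'Z AB'.
have n0 : cone_near C r x0 (h' *m B + th *: (h' *m A)).
  rewrite addrC scalemxAr -mulmxDr -[x0]mul1mx -h'h -mulmxA.
  exact: cone_near_map.
have n1 : cone_near C r (h' *m x0) (th *: (h' *m B) + th *: (h' *m A)).
  rewrite -scalerDr addrC -mulmxDr.
  apply: (cone_nearZ (a := 1) (b := th^-1) CC); rewrite ?invr_gt0//.
  by rewrite scale1r scalerA mulVf ?lt0r_neq0// scale1r; exact: cone_near_map.
have [phi phiP] := contraction CC k0 kf0 Ck fk e0 Cx0 Ce KA KB nA nB D0 th0
  (cone_morse_map h'C hC h'h hh' Ml) line seg CAB thn n0 n1 h'C.
(* The contraction estimate for [h'] is applied to [h *m v], so its form is composed with [h]; [w]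
   is the preimage of [x0] under [a *: h]. *)
apply: (gap_bottom (phi := phi *m h) (w := a^-1 *: (h' *m x0))) => //.
  by rewrite -scalemxAl -scalemxAr scalerA mulfV// scale1r mulmxA hh' mul1mx.
move=> v; rewrite -mulmxA => /phiP; rewrite mulmxA h'h mul1mx => H.
apply: le_trans H _; rewrite -scalemxAl !normrZ normfV.
rewrite [leRHS](_ : _ = tau * `|h *m v| * `|h' *m x0| * (`|a| / `|a|)); last by ring.
by rewrite mulfV ?normr_eq0// mulr1.
Qed.

End Thin.
End Gaps.

(** * Lifting automorphisms to the cone *)

Section Group.
Variables (R : realType) (d : nat) (Omega : set (pspace R d)).
Local Notation P := (pspace R d).
Implicit Types (p q : P) (X Y v w : 'cV[R]_d) (g : PGL R d).
Local Notation mx g := (val (repr g)).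

Lemma act_represents g p v : represents p v -> represents (PGL_act g p) (mx g *m v).
Proof.
move=> [a a0 ->]; rewrite -scalemxAr; apply: representsZ => //.
exact: (represents_pi (GL_act (repr g) (repr p))).
Qed.

Lemma mx_unit g : mx g \in unitmx.
Proof. exact: GLP. Qed.

Lemma mx_inv g : exists2 a : R, a != 0 & mx (g^-1)%g = a *: invmx (mx g).
Proof. exact: (pgl_reprP (GL_inv (repr g))). Qed.

Lemma mx_divl g g' : exists2 a : R, a != 0 & mx (g^-1 * g')%g = a *: (invmx (mx g) *m mx g').
Proof.
have [a a0 aE] := pgl_reprP (GL_mul (repr (g^-1)%g) (repr g')).
have [b b0 bE] := mx_inv g.
exists (a * b); first exact: mulf_neq0.
by rewrite [LHS]aE /= bE -scalemxAl scalerA.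
Qed.

Variables (f : 'rV[R]_d) (k : R).
Hypotheses (oO : open Omega) (Of : closure Omega `<=` chart f).
Hypothesis cvxO : convex_in_chart f Omega.
Hypothesis O0 : Omega !=set0.
Local Notation C := (omega_cone Omega f).
Hypothesis k0 : 0 < k.
Hypothesis Ck : forall x, C x -> `|x| <= k * form f x.

Let CC := omega_cone_open_cone oO Of cvxO.

(** [f] composed with the matrix of [g] does not vanish on [C], so a scalar makes it positive there.
    The statement for the inverse uses that [g] maps [Omega] onto itself. *)
Lemma aut_lift g : proj_aut Omega g -> exists2 c : R, c != 0 &
  (forall x, C x -> C ((c *: mx g) *m x)) /\
  (forall x, C x -> C (invmx (c *: mx g) *m x)).
Proof.
move=> gO.
have gOin p : Omega p -> Omega (PGL_act g p) by move=> Op; rewrite -gO; exists p.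
have fg x : C x -> form (f *m mx g) x != 0.
  move=> [p [Op px _]]; rewrite /form -mulmxA.
  by apply: (represents_form (act_represents g px)); apply: Omega_chart (gOin _ Op).
have Cne : C !=set0 by have [p Op] := O0; exists (chart_coord f p); exact: omega_cone_chart.
have [c c0 cC] := form_sign CC Cne fg.
have gC x : C x -> C ((c *: mx g) *m x).
  move=> Cx; have [p [Op px _]] := Cx; exists (PGL_act g p); split; first exact: gOin.
    by rewrite -scalemxAl; apply: representsZ => //; exact: act_represents.
  by rewrite -scalemxAl formZ; have := cC _ Cx; rewrite /form mulmxA.
exists c => //; split => // x Cx.
have cu : c *: mx g \in unitmx by rewrite unitmxZ ?unitfE// mx_unit.
have [p [Op px _]] := Cx; have [q Oq qp] : (PGL_act g @` Omega) p by rewrite gO.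
have Cy := omega_cone_chart Of Oq; set y := chart_coord f q in Cy.
have yr : represents p ((c *: mx g) *m y).
  rewrite -qp -scalemxAl; apply: representsZ => //; apply: act_represents.
  exact/represents_chart/(Omega_chart Of).
have [a a0 xE] := represents_collinear yr px.
rewrite xE -scalemxAr mulKmx//; apply: (coneZ CC) => //.
by apply: (omega_cone_scale oO Of cvxO a0 (gC _ Cy)); rewrite -xE.
Qed.

Lemma near_act r g c p q X Y : c != 0 ->
  (forall x, C x -> C (invmx (c *: mx g) *m x)) ->
  represents p X -> represents q Y -> C X -> C Y ->
  hilbert_dist Omega p (PGL_act (g^-1)%g q) < r ->
  cone_near C r X (invmx (c *: mx g) *m Y).
Proof.
move=> c0 gC pX qY CX CY; apply/(iffLR (hilbert_dist_near oO Of cvxO O0 Ck _ pX _ CX _)).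
  have [a a0 aE] := mx_inv g.
  have := act_represents (g^-1)%g qY; rewrite aE invmxZ ?unitmxZ ?unitfE ?mx_unit// => H.
  rewrite -scalemxAl (_ : c^-1 *: _ = (c^-1 / a) *: (a *: invmx (mx g) *m Y)).
    by apply: representsZ => //; rewrite mulf_neq0 ?invr_eq0.
  by rewrite -scalemxAl scalerA divfK.
exact: gC.
Qed.

End Group.

(** * Divergence *)

Section CompactPGL.
Variables (R : realType) (d : nat).
Implicit Types (v : 'cV[R]_d) (m : 'M[R]_d).

Definition bilipschitz N m : Prop :=
  (forall v, `|m *m v| <= N * `|v|) /\ (forall v, `|v| <= N * `|m *m v|).

Lemma mulmx_norm_le m v : `|m *m v| <= d%:R * `|m| * `|v|.
Proof.
apply: norm_le_coord => [|i]; first by rewrite !mulr_ge0.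
rewrite mxE; apply: le_trans (ler_norm_sum _ _ _) _.
have -> : d%:R * `|m| * `|v| = \sum_(j < d) `|m| * `|v|.
  by rewrite sumr_const card_ord -mulrA mulr_natl.
apply: ler_sum => j _; rewrite normrM; apply: ler_pM => //; last exact: coord_le_norm.
by rewrite [leRHS]/normr/= mx_normrE; apply/bigmax_geP; right; exists (i, j).
Qed.

Lemma bilipschitzW N N' m : N <= N' -> bilipschitz N m -> bilipschitz N' m.
Proof.
move=> NN' [h1 h2]; split=> v.
  by apply: le_trans (h1 v) _; rewrite ler_wpM2r.
by apply: le_trans (h2 v) _; rewrite ler_wpM2r.
Qed.

Lemma locally_bilipschitz (g0 : PGL R d) : exists (N : nat) (U : set (PGL R d)),
  [/\ open U, U g0 & forall g, U g ->
    exists2 m : GL R d, \pi_(PGL R d) m = g & bilipschitz N%:R (val m)].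
Proof.
pose m0 := val (repr g0); have m0u : m0 \in unitmx by exact: GLP.
pose L := d%:R * `|invmx m0| + 1.
have L0 : 0 < L by rewrite ltr_wpDl// mulr_ge0.
have Lv v : `|v| <= L * `|m0 *m v|.
  rewrite -{1}(mulKmx m0u v); apply: le_trans (mulmx_norm_le _ _) _.
  by rewrite ler_wpM2r// lerDl.
pose D : R := d%:R + 1; have D0 : 0 < D by rewrite ltr_wpDl.
(* With this radius a perturbation of [m0] moves [v] by at most [|v| / (2 * L)], half of the lower
   bound that [m0] provides. *)
pose del := (2 * L * D)^-1.
have del0 : 0 < del by rewrite invr_gt0 !mulr_gt0.
have near_m m : ball m0 del m -> bilipschitz (2 * L + d%:R * (`|m0| + del)) m.
  rewrite -ball_normE/= => mm; split=> v.
    apply: le_trans (mulmx_norm_le _ _) _; rewrite ler_wpM2r//.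
    apply: (@le_trans _ _ (d%:R * (`|m0| + del))); last by rewrite lerDr mulr_ge0 ?ltW.
    rewrite ler_wpM2l// -[m](subKr m0); apply: le_trans (ler_normB _ _) _.
    by rewrite lerD2l ltW.
  have h1 : `|(m0 - m) *m v| <= D * del * `|v|.
    apply: le_trans (mulmx_norm_le _ _) _; rewrite ler_wpM2r//.
    by apply: ler_pM => //; [rewrite lerDl|exact: ltW].
  have h2 : `|m0 *m v| <= `|m *m v| + D * del * `|v|.
    have -> : m0 *m v = m *m v + (m0 - m) *m v by rewrite -mulmxDl addrC subrK.
    by apply: le_trans (ler_normD _ _) _; rewrite lerD2l.
  have h3 : L * (D * del) = 2^-1.
    by rewrite /del; field; do ?[apply/andP; split]; exact: lt0r_neq0.
  have h4 : `|v| <= L * `|m *m v| + 2^-1 * `|v|.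
    by apply: le_trans (Lv v) _; rewrite -h3 -mulrA -mulrDr ler_pM2l.
  apply: (@le_trans _ _ (2 * L * `|m *m v|)); first by rewrite -mulrA; lra.
  by rewrite ler_wpM2r// lerDl mulr_ge0// addr_ge0// ltW.
pose N := Num.bound (2 * L + d%:R * (`|m0| + del)).
pose U : set (PGL R d) := [set g | exists2 m : GL R d, ball m0 del (val m) & \pi_(PGL R d) m = g].
exists N, U; split.
- pose B : set 'M[R]_d := \bigcup_(a in [set a : R | a != 0]) ((fun u => a *: u) @^-1` ball m0 del).
  exists B.
    apply: bigcup_open => a _; apply: open_comp; last exact: ball_open.
    by move=> u _; apply: scaler_continuous.
  apply/seteqP; split => u /=.
    move=> [a a0 /= au]; have uu : a *: val u \in unitmx.
      by rewrite unitmxZ ?unitfE// GLP.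
    by exists (GL_of uu) => //; apply/pgl_piP; exists a.
  by move=> [m mm /pgl_piP[a a0 mE]]; exists a => //=; rewrite -mE.
- by exists (repr g0); [exact: ballxx|rewrite reprK].
- move=> g [m mm mg]; exists m => //; apply: bilipschitzW (near_m _ mm).
  by apply/ltW/archi_boundP; rewrite addr_ge0// mulr_ge0// ?addr_ge0// ltW.
Qed.

(** Choose a counterexample for every [N]. Near a cluster point of this sequence one bound holds
    uniformly, against counterexamples of larger index. *)
Lemma compact_bilipschitz (K : set (PGL R d)) : compact K -> exists N : nat,
  forall g, K g -> exists2 m : GL R d, \pi_(PGL R d) m = g & bilipschitz N%:R (val m).
Proof.
move=> cK; apply: contrapT => nN.
pose bad (N : nat) (g : PGL R d) := K g /\
  ~ exists2 m : GL R d, \pi_(PGL R d) m = g & bilipschitz N%:R (val m).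
have bad_ex N : {g | bad N g}.
  apply: cid; apply: contrapT => nb; apply: nN; exists N => g Kg.
  by apply: contrapT => ng; apply: nb; exists g.
pose s N := sval (bad_ex N); have sP N : bad N (s N) := svalP (bad_ex N).
have FK : (s @ \oo) K by exists 0%N => // n _; have [] := sP n.
have [g0 [_ cl]] := cK (s @ \oo) _ FK.
have [N [U [oU Ug HU]]] := locally_bilipschitz g0.
have [|g [[n /= Nn <-] /HU[m mg mN]]] := cl [set s n | n in [set n | (N <= n)%N]] U _
  (open_nbhs_nbhs (conj oU Ug)).
  by exists N => // n /= Nn; exists n.
have [_] := sP n; apply; exists m => //.
by apply: bilipschitzW mN; rewrite ler_nat.
Qed.

End CompactPGL.

Section Divergence.
Variables (R : realType) (d : nat) (Omega : set (pspace R d)).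
Local Notation P := (pspace R d).
Local Notation mx g := (val (repr g)).
Variables (f : 'rV[R]_d) (k : R).
Hypotheses (oO : open Omega) (Of : closure Omega `<=` chart f).
Hypothesis cvxO : convex_in_chart f Omega.
Local Notation C := (omega_cone Omega f).
Hypothesis k0 : 0 < k.
Hypothesis Ck : forall x, C x -> `|x| <= k * form f x.

Let CC := omega_cone_open_cone oO Of cvxO.

(** The unknown scalar [a] cancels in the product of the two factors, leaving at most the square
    [(N * |x0| / e) ^+ 2]; the crude radius comes from [X < 1 + 2 * X <= expR (2 * X)]. *)
Lemma bilipschitz_near (m : GL R d) (a N e : R) (x0 : 'cV[R]_d) :
  0 < e -> (forall v, `|v| <= e -> C (x0 + v)) -> C x0 ->
  a != 0 -> (forall x, C x -> C ((a *: val m) *m x)) ->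
  bilipschitz N (val m) ->
  cone_near C ((N * `|x0| / e) ^+ 2) x0 ((a *: val m) *m x0).
Proof.
move=> e0 Ce Cx0 a0 mC [h1 h2].
have mu : a *: val m \in unitmx by rewrite unitmxZ ?unitfE// GLP.
set M := a *: val m in mC mu *; pose y := invmx M *m x0.
have x00 : x0 != 0 by apply: contraPneq Cx0 => ->; exact: cone0.
have My : M *m y = x0 by rewrite mulKVmx.
have y0 : 0 < `|y|.
  by rewrite normr_gt0; apply: contraNneq x00 => y0; rewrite -My y0 mulmx0.
have Mx0 : 0 < `|M *m x0|.
  rewrite normr_gt0; apply: contraNneq x00 => Mx; rewrite -(mulKmx mu x0) Mx.
  by rewrite mulmx0.
have ball_scale c v : 0 < c -> `|v| <= c * e -> C (c *: x0 - v).
  move=> c0 vc; have -> : c *: x0 - v = c *: (x0 + (- c^-1) *: v).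
    by vec; field; exact: lt0r_neq0.
  apply: (coneZ CC c0); apply: Ce; rewrite normrZ normrN gtr0_norm ?invr_gt0//.
  by rewrite ler_pdivrMl.
exists (`|y| / e), (`|M *m x0| / e); split; rewrite ?divr_gt0//.
- apply: (@le_lt_trans _ _ ((N * `|x0| / e) ^+ 2)); last first.
    apply: lt_le_trans (expR_ge1Dx _).
    by have := sqr_ge0 (N * `|x0| / e); lra.
  rewrite mulrACA -invfM -expr2 expr_div_n ler_pM2r ?invr_gt0 ?exprn_gt0//.
  have H1 : `|M *m x0| <= `|a| * (N * `|x0|).
    by rewrite /M -scalemxAl normrZ ler_wpM2l.
  have H2 : `|y| <= N * `|x0| / `|a|.
    rewrite ler_pdivlMr ?normr_gt0// -My /M -scalemxAl normrZ mulrCA mulrC.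
    by rewrite ler_wpM2l.
  apply: le_trans (ler_pM _ _ H2 H1) _ => //.
  rewrite [leLHS](_ : _ = (N * `|x0|) ^+ 2 * (`|a| / `|a|)); last by ring.
  by rewrite mulfV ?normr_eq0// mulr1.
- have -> : (`|y| / e) *: (M *m x0) - x0 = M *m ((`|y| / e) *: x0 - y).
    by rewrite mulmxBr My scalemxAr.
  by apply: mC; apply: ball_scale; rewrite ?divr_gt0// divfK// lt0r_neq0.
- by apply: ball_scale; rewrite ?divr_gt0// divfK// lt0r_neq0.
Qed.

(** If [gamma n] lies in a compact set, it moves [p0] a bounded distance and also takes it within
    [r] of [c n], which is at distance [n] from [c 0]. This bounds [n]. *)
Lemma tracking_divergent (c : R -> P) (gamma : nat -> PGL R d) (r : R) (p0 : P) :
  Omega p0 -> projective_geodesic_ray Omega c -> (forall n, proj_aut Omega (gamma n)) ->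
  tracks Omega r p0 c gamma -> divergent gamma.
Proof.
move=> Op0 rc gaut trk K /compact_bilipschitz[N HN].
have O0 : Omega !=set0 by exists p0.
have [[cO geo] _] := rc.
set x0 := chart_coord f p0; have Cx0 : C x0 by exact: omega_cone_chart.
have p0r : represents p0 x0 by exact/represents_chart/(Omega_chart Of).
have [e e0 Ce] := cone_open CC Cx0.
pose X n := chart_coord f (c n%:R : P).
have CX n : C (X n) by apply: omega_cone_chart => //; exact: cO.
have Xr n : represents (c n%:R) (X n) by apply/represents_chart/(Omega_chart Of)/cO.
pose rho := hilbert_dist Omega (c 0%:R) p0 + 1.
have nr0 : cone_near C rho (X 0%N) x0.
  apply/(iffLR (hilbert_dist_near oO Of cvxO O0 Ck rho (Xr 0%N) p0r (CX 0%N) Cx0)).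
  by rewrite ltrDl.
pose S := rho + (N%:R * `|x0| / e) ^+ 2 + r.
exists (Num.bound `|S|) => // n /= Sn Kn.
have [a a0 [gC g'C]] := aut_lift oO Of cvxO O0 (gaut n).
have nr2 := near_act oO Of cvxO O0 Ck a0 g'C p0r (Xr n) Cx0 (CX n) (trk n).
have [m mg mN] := HN _ Kn.
have [b b0 bE] := pgl_reprP m.
have ME : a *: mx (gamma n) = (a * b) *: val m by rewrite -scalerA -bE mg.
have au : a *: mx (gamma n) \in unitmx by rewrite unitmxZ ?unitfE// mx_unit.
have nr1 : cone_near C ((N%:R * `|x0| / e) ^+ 2) x0 ((a *: mx (gamma n)) *m x0).
  rewrite ME; apply: bilipschitz_near => //; first exact: mulf_neq0.
  by rewrite -ME.
have := cone_near_map gC nr2; rewrite mulKVmx// => nr3.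
have := cone_near_trans CC (cone_near_trans CC nr0 nr1) nr3.
move=> /(iffRL (hilbert_dist_near oO Of cvxO O0 Ck _ (Xr 0%N) (Xr n) (CX 0%N) (CX n))).
rewrite geo// sub0r normrN ger0_norm// -/S => nS.
have : S < n%:R.
  apply: (@lt_le_trans _ _ (Num.bound `|S|)%:R); last by rewrite ler_nat.
  apply: le_lt_trans (ler_norm _) _; rewrite archi_boundP//.
by move=> /(lt_trans nS); rewrite ltxx.
Qed.

End Divergence.

(** * Uniform regularity *)

Section Numerics.
Variable R : realType.

(** For large [m] the additive constants are absorbed: [u] exceeds [kap * m / 2] and [v] is below
    [3 * m], so the ratio exceeds [kap / 6]. The inequality [u <= v] gives [0 < v]. *)
Lemma ratio_lower_bound (kap c3 c4 : R) : 0 < kap -> exists N : nat, (0 < N)%N /\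
  forall (m : nat) (u v : R), (N < m)%N ->
    kap * m%:R - c4 <= u -> v <= 2 * m%:R + c3 -> u <= v -> kap / 8 < u / v.
Proof.
move=> kap0; pose b : R := `|2 * c4 / kap| + `|c3|.
exists (Num.bound b).+1; split=> // m u v Nm hu hv uv.
have mb : b < m%:R.
  apply: (@lt_le_trans _ _ (Num.bound b)%:R).
    by apply: archi_boundP; rewrite addr_ge0.
  by rewrite ler_nat; exact: ltnW (ltnW Nm).
have m4 : 2 * c4 < kap * m%:R.
  rewrite -ltr_pdivrMl// mulrC; apply: le_lt_trans mb.
  by apply: le_trans (ler_norm _) _; rewrite /b lerDl.
have m3 : c3 < m%:R.
  by apply: le_lt_trans mb; apply: le_trans (ler_norm _) _; rewrite /b lerDr.
have m0 : 0 < m%:R :> R by rewrite ltr0n; exact: leq_ltn_trans Nm.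
have km : 0 < kap * m%:R by exact: mulr_gt0.
have v0 : 0 < v by lra.
rewrite ltr_pdivlMr//; apply: (@le_lt_trans _ _ (kap / 8 * (3 * m%:R))).
  by rewrite ler_wpM2l ?divr_ge0 ?ltW//; lra.
by rewrite mulrCA; lra.
Qed.

Lemma ln_ratio_ge (s1 s0 q c t : R) (i : nat) : 0 < s1 -> 0 < s0 -> 0 < q -> 0 < c ->
  0 <= t -> t <= c * q ^- i -> forall b, 0 < b -> s1 ^+ 2 <= b * t ^+ 2 * s0 ^+ 2 ->
  i%:R * ln q - ln (b * c ^+ 2) / 2 <= ln (s0 / s1).
Proof.
move=> s10 s00 q0 c0 t0 tq b b0 H.
have qi : 0 < q ^+ i by rewrite exprn_gt0.
have t2 : t ^+ 2 <= c ^+ 2 * (q ^+ i) ^- 2.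
  by rewrite -exprVn -exprMn ler_pXn2r ?nnegrE// mulr_ge0 ?invr_ge0 ?ltW.
have : s1 ^+ 2 * (q ^+ i) ^+ 2 <= b * c ^+ 2 * s0 ^+ 2.
  rewrite -ler_pdivlMr ?exprn_gt0//; apply: le_trans H _.
  rewrite [leRHS](_ : _ = b * (c ^+ 2 * (q ^+ i) ^- 2) * s0 ^+ 2); last by ring.
  by rewrite ler_pM2r ?exprn_gt0// ler_pM2l.
rewrite -ler_ln ?posrE ?mulr_gt0 ?exprn_gt0//.
have -> : ln (s1 ^+ 2 * (q ^+ i) ^+ 2) = 2 * ln s1 + 2 * (i%:R * ln q).
  by rewrite lnM ?posrE ?exprn_gt0// (lnXn 2 s10) (lnXn 2 qi) (lnXn i q0) !mulr_natl.
have -> : ln (b * c ^+ 2 * s0 ^+ 2) = ln (b * c ^+ 2) + 2 * ln s0.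
  by rewrite lnM ?posrE ?mulr_gt0 ?exprn_gt0// (lnXn 2 s00) mulr_natl.
rewrite ln_div ?posrE//; lra.
Qed.

Lemma ln_ratio_le (s1 s0 t : R) : 0 < s1 -> 0 < s0 -> 0 < t ->
  s0 ^+ 2 <= t ^+ 2 * s1 ^+ 2 -> ln (s0 / s1) <= ln t.
Proof.
move=> s10 s00 t0; rewrite -exprMn => H.
have {}H : s0 <= t * s1.
  have ts : 0 < t * s1 by exact: mulr_gt0.
  by move: H; rewrite ler_pXn2r// nnegrE ltW.
by rewrite ler_ln ?posrE ?divr_gt0// ler_pdivrMr.
Qed.

End Numerics.

Lemma properly_convex_bound (R : realType) (d : nat) (Omega : set (pspace R d))
    (f : 'rV[R]_d) : closure Omega `<=` chart f ->
  bounded_set (chart_coord f @` closure Omega) ->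
  exists2 k : R, 0 < k & forall x, omega_cone Omega f x -> `|x| <= k * form f x.
Proof.
move=> Of /ex_strict_bound_gt0[k k0 bk]; exists k => // x [p [Op px fx]].
have -> : x = form f x *: chart_coord f p.
  by rewrite (chart_coordE f px) scalerA mulfV ?lt0r_neq0// scale1r.
rewrite normrZ gtr0_norm// formZ form_chart_coord; last by apply: Of; exact: subset_closure.
rewrite mulr1 mulrC ler_pM2r// ltW//; apply: bk.
by exists p => //; exact: subset_closure.
Qed.

Theorem theorem1p6 (R : realType) (d : nat) (hd : (1 < d)%N)
  (Omega : set (pspace R d)) (hOmega : properly_convex Omega)
  (x0 : pspace R d) (hx0 : Omega x0) (r : R) (hr : 0 < r) (M : morse_gauge R) :
  exists (C : R) (N : nat), [/\ 0 < C, (0 < N)%N &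
    forall (c : R -> pspace R d) (gamma : nat -> PGL R d),
      projective_geodesic_ray Omega c ->
      (forall n, proj_aut Omega (gamma n)) ->
      tracks Omega r x0 c gamma ->
      morse Omega M (ray_image c) ->
      strongly_uniformly_regular_with 1 C N gamma /\
      strongly_uniformly_regular_with d.-1 C N gamma].
Proof.
have [ne0 oO [f [Of cvxO _ bO]]] := hOmega.
have [k k0 Ck] := properly_convex_bound Of bO.
have CC := omega_cone_open_cone oO Of cvxO.
set C := omega_cone Omega f in Ck CC.
pose kf : R := \sum_j `|f 0 j| + 1.
have kf0 : 0 < kf by rewrite ltr_wpDl// sumr_ge0.
have fk (x : 'cV[R]_d) : form f x <= kf * `|x|.
  by apply: le_trans (form_le_norm f x) _; rewrite ler_wpM2r// lerDl.
set X0 := chart_coord f x0; have CX0 : C X0 by exact: omega_cone_chart.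
have X0r : represents x0 X0 by exact/represents_chart/(Omega_chart Of).
have [e e0 Ce] := cone_open CC CX0.
have fX0 : 0 < form f X0 by exact: (form_cone_gt0 CC k0 Ck CX0).
set D := morse_radius M.
have D0 : 0 < D by rewrite ltr_wpDl.
pose q : R := 1 + expR (- (2 * D + 1)) / 2.
have q1 : 1 < q by rewrite ltrDl divr_gt0 ?expR_gt0.
have q0 : 0 < q by lra.
have q2 : q <= 2.
  have : expR (- (2 * D + 1)) <= expR 0 by rewrite ler_expR; lra.
  by rewrite expR0 /q; lra.
pose s : R := expR (- (2 * (2 * D + 1))) / 2.
(* One window is allotted to each stretch of length [W] of the ray. The extra 1 in the bound pays
   for the factor 1/2 in [s], because [2 <= expR 1]. *)
pose W := (Num.bound (2 * (2 * D + 1) + 1)).+1.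
have sW : expR (- W%:R) <= s.
  have W1 : 2 * (2 * D + 1) + 1 <= W%:R.
    apply: le_trans (ltW (archi_boundP _)) _; first lra.
    by rewrite ler_nat.
  rewrite /s ler_pdivlMr//.
  apply: (@le_trans _ _ (expR (- W%:R) * expR 1)).
    by rewrite ler_pM2l ?expR_gt0//; apply: le_trans (expR_ge1Dx _); lra.
  by rewrite -expRD ler_expR; lra.
(* The factor 2 covers the two terms [q ^- i] and [th], both at most [q ^- i]. *)
pose cc := contraction_constant f k kf X0 e r * (k * 2).
have cc0 : 0 < cc by rewrite !mulr_gt0 ?expR_gt0 ?invr_gt0.
have d0 : (0 < d)%N by exact: ltnW.
have X00 : X0 != 0 by exact: represents_neq0 X0r.
pose b := d%:R * sqnorm X0.
have b0 : 0 < b by rewrite mulr_gt0 ?ltr0n// sqnorm_gt0.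
pose t2 := d%:R * ((k * kf / e) ^+ 2 * (k * form f X0) ^+ 2).
have t20 : 0 < t2 by rewrite mulr_gt0 ?ltr0n// mulr_gt0// exprn_gt0// ?mulr_gt0// invr_gt0.
have lnq : 0 < ln q by rewrite ln_gt0.
have W0 : 0 < W%:R :> R by rewrite ltr0n.
pose kap := ln q / W%:R.
have kap0 : 0 < kap by exact: divr_gt0.
have [N [N0 NP]] := ratio_lower_bound (ln t2 + 2 * (r + r + 1))
  (ln q + ln (b * cc ^+ 2) / 2) kap0.
(* The choices made so far involve only [Omega], [x0], [r] and [M]; the ray and the sequence are
   introduced afterwards. *)
exists (kap / 8), N; split => //; first by rewrite divr_gt0.
move=> c gamma rc gaut trk morse_c.
have div : divergent gamma by exact: (tracking_divergent oO Of cvxO Ck hx0 rc gaut trk).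
suff gaps n m : (N < m)%N -> let h := ((gamma n)^-1 * gamma (n + m)%N)%g in
    kap / 8 < mu_gap 1 2 h / mu_gap 1 d h /\ kap / 8 < mu_gap d.-1 d.-1.+1 h / mu_gap 1 d h.
  by split; split => // n m Nm; case: (gaps n m Nm).
move=> Nm h.
have [[cO geo] _] := rc.
pose X j := chart_coord f (c j%:R : pspace R d).
have CX j : C (X j) by apply: omega_cone_chart => //; exact: cO.
have Xr j : represents (c j%:R) (X j) by apply/represents_chart/(Omega_chart Of)/cO.
have [a1 a10 [g1C g1'C]] := aut_lift oO Of cvxO ne0 (gaut n).
have [a2 a20 [g2C g2'C]] := aut_lift oO Of cvxO ne0 (gaut (n + m)%N).
set g1 := a1 *: _ in g1C g1'C; set g2 := a2 *: _ in g2C g2'C.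
have u1 : g1 \in unitmx by rewrite unitmxZ ?unitfE// mx_unit.
have u2 : g2 \in unitmx by rewrite unitmxZ ?unitfE// mx_unit.
have near1 := near_act oO Of cvxO ne0 Ck a10 g1'C X0r (Xr n) CX0 (CX n) (trk n).
have near2 := near_act oO Of cvxO ne0 Ck a20 g2'C X0r (Xr (n + m)%N) CX0 (CX _) (trk _).
rewrite -/g1 -/g2 in near1 near2.
pose H := invmx g1 *m g2; pose H' := invmx g2 *m g1.
have HC x : C x -> C (H *m x) by move=> Cx; rewrite -mulmxA; exact/g1'C/g2C.
have H'C x : C x -> C (H' *m x) by move=> Cx; rewrite -mulmxA; exact/g2'C/g1C.
have HH' : H *m H' = 1%:M by rewrite /H /H' mulmxA mulmxK// mulVmx.
have H'H : H' *m H = 1%:M by rewrite /H /H' mulmxA mulmxK// mulVmx.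
have [a a0 hE] : exists2 a : R, a != 0 & val (repr h) = a *: H.
  have [a a0 aE] := mx_divl (gamma n) (gamma (n + m)%N).
  exists (a * (a1 / a2)); first by rewrite !mulf_neq0 ?invr_eq0.
  rewrite aE /H /g1 /g2 invmxZ ?unitmxZ ?unitfE ?mx_unit//.
  rewrite -!scalemxAl -!scalemxAr !scalerA; congr (_ *: _); field.
  by do ?[apply/andP; split].
have m0 : (0 < m)%N by exact: leq_ltn_trans Nm.
have nm : n%:R != (n + m)%:R :> R by rewrite eqr_nat -[n in n == _]addn0 eqn_add2l eq_sym -lt0n.
have [A [B [c1 [c2 [AB c10 c20 XA XB]]]]] := ray_chord oO Of cvxO ne0 Ck rc
  (ler0n _ n) (ler0n _ (n + m)) nm (Xr n) (Xr (n + m)%N) (CX n) (CX _).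
have nmE : `|n%:R - (n + m)%:R| = m%:R :> R.
  by rewrite natrD opprD addrA subrr sub0r normrN ger0_norm.
rewrite nmE in AB XB; set th := expR (- (2 * m%:R)) in AB XB.
have th0 : 0 < th by exact: expR_gt0.
have AB1 := chord_segment_map g1'C g1C (mulVmx u1) (mulmxV u1) AB.
have Ml := cone_morse_map g1'C g1C (mulVmx u1) (mulmxV u1)
  (morse_ray_cone oO Of cvxO ne0 Ck rc morse_c).
set l := [set _ | _ in _] in AB1 Ml.
have lZ z t : 0 < t -> l z -> l (t *: z).
  by move=> t0 [y ly <-]; exists (t *: y); rewrite ?scalemxAr//; exact: ray_coneZ.
have nA : cone_near C r X0 (invmx g1 *m A + invmx g1 *m B).
  apply: (cone_nearZ (a := 1) (b := c1) CC) => //.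
  by rewrite scale1r -mulmxDr scalemxAr -XA.
have nB : cone_near C r (H *m X0) (th *: (invmx g1 *m A) + invmx g1 *m B).
  apply: (cone_nearZ (a := 1) (b := c2) CC) => //.
  rewrite scale1r scalemxAr -mulmxDr scalemxAr -XB.
  by have := cone_near_map HC near2; rewrite /H -!mulmxA mulKVmx.
(* The ends of the segment are at distance exactly [m]; the added 1 makes the inequality strict. *)
have nH : cone_near C (r + (m%:R + 1) + r) X0 (H *m X0).
  apply: (cone_near_trans CC) (cone_near_sym nB).
  apply: (cone_near_trans CC) nA _.
  have [AB1c _ _] := AB1; apply/(chord_near CC _ AB1c th0).
    by rewrite /th -[leRHS]expR0 ler_expR; have := ler0n R m; clear; lra.
  by rewrite /th -expRD -[ltLHS]expR0 ltr_expR; clear; lra.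
(* Number of windows used; rounding down costs at most one of them, the term [ln q] in the additive
   constant. As [i * W <= m], the height [expR (- (2 * m))] is below [expR (- (i * W))] by a factor
   [expR (- m)], which absorbs the 2 required by the windows. *)
pose i := (m %/ W)%N.
have iW : (i * W <= m)%N by exact: leq_trunc_div.
have im : m%:R / W%:R - 1 <= i%:R :> R.
  rewrite lerBlDr ler_pdivrMr//.
  have : (m <= i.+1 * W)%N by rewrite ltnW// ltn_ceil.
  by rewrite -(ler_nat R) natrM -natr1.
have m1 : 1 <= m%:R :> R by rewrite ler1n.
have thi : 2 * th <= s ^+ i.
  apply: (@le_trans _ _ (expR (- W%:R) ^+ i)); last first.
    by apply: lerXn2r => //; rewrite ?nnegrE ?expR_ge0//; apply: le_trans sW; exact: expR_ge0.
  apply: (@le_trans _ _ (expR 1 * th)).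
    by rewrite ler_pM2r//; apply: le_trans (expR_ge1Dx _); clear; lra.
  rewrite -expRM_natr /th -expRD ler_expR.
  have : i%:R * W%:R <= m%:R :> R by rewrite -natrM ler_nat.
  by move: m1; clear; nra.
have qi0 : 0 < q ^+ i by rewrite exprn_gt0.
have thq : th <= q ^- i.
  rewrite /th expRN lef_pV2 ?posrE ?expR_gt0//.
  apply: (@le_trans _ _ (expR 1 ^+ i)).
    apply: lerXn2r => //; rewrite ?nnegrE ?expR_ge0 ?(ltW q0)//.
    by apply: le_trans q2 _; apply: le_trans (expR_ge1Dx _); clear; lra.
  rewrite -expRM_natr mul1r ler_expR.
  have : (i <= m)%N by exact: leq_div.
  by rewrite -(ler_nat R); have := ler0n R m; clear; lra.
pose cc1 := contraction_constant f k kf X0 e r.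
have cc10 : 0 < cc1 by rewrite !mulr_gt0 ?expR_gt0 ?invr_gt0.
have tauE : cc1 * (k * (q ^- i + th)) <= cc * q ^- i.
  rewrite [leRHS](_ : _ = cc1 * (k * (q ^- i + q ^- i))); last by rewrite /cc -/cc1; ring.
  by rewrite ler_pM2l// ler_pM2l// lerD2l.
have tau0 : 0 <= cc1 * (k * (q ^- i + th)).
  by apply/ltW/mulr_gt0 => //; apply: mulr_gt0 => //; apply: addr_gt0; rewrite ?invr_gt0.
have top := scaled_gap_top CC k0 kf0 Ck fk e0 CX0 Ce a HC hd D0 th0 Ml AB1 nA nB thi.
have bot := scaled_gap_bottom CC k0 kf0 Ck fk e0 CX0 Ce HC H'C HH' H'H a0 hd D0 th0 Ml lZ AB1 nA nB thi.
have tot := scaled_sv_ratio CC k0 kf0 Ck fk e0 CX0 Ce a HC H'C H'H d0 nH.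
rewrite -hE -/cc1 -/q in top bot tot.
have sv0 j : (j < d)%N -> 0 < (singular_values (val (repr h)))`_j.
  by move=> jd; apply: sv_gt0 => //; exact: mx_unit.
have d1d : (d.-1 < d)%N by rewrite ltn_predL.
have d2d : (d.-2 < d)%N by rewrite -subn2 ltn_subrL.
have [_ [_ _ _ _ sle]] := singular_values_spectrum (val (repr h)).
have tot' : mu_gap 1 d h <= 2 * m%:R + (ln t2 + 2 * (r + r + 1)).
  rewrite /mu_gap /sing_val /=.
  apply: (@le_trans _ _ (ln (t2 * expR (2 * (r + (m%:R + 1) + r))))).
    apply: ln_ratio_le; [exact: sv0|exact: sv0|by rewrite mulr_gt0 ?expR_gt0|].
    by move: tot; rewrite mulrA.
  by rewrite lnM ?posrE ?expR_gt0// expRK; clear; lra.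
have low (sa sb : R) : 0 < sa -> 0 < sb ->
    sa ^+ 2 <= d%:R * (cc1 * (k * (q ^- i + th))) ^+ 2 * sqnorm X0 * sb ^+ 2 ->
    kap * m%:R - (ln q + ln (b * cc ^+ 2) / 2) <= ln (sb / sa).
  move=> sa0 sb0 Hs.
  have Hs' : sa ^+ 2 <= b * (cc1 * (k * (q ^- i + th))) ^+ 2 * sb ^+ 2.
    by apply: le_trans Hs _; rewrite /b [d%:R * sqnorm X0 * _]mulrAC.
  apply: le_trans (ln_ratio_ge sa0 sb0 q0 cc0 tau0 tauE b0 Hs').
  have : kap * m%:R - ln q <= i%:R * ln q.
    rewrite [leLHS](_ : _ = (m%:R / W%:R - 1) * ln q); last by rewrite /kap; ring.
    by rewrite ler_pM2r.
  by clear; lra.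
have gap_le (sa sb : R) : 0 < sa -> 0 < sb ->
    (singular_values (val (repr h)))`_d.-1 <= sa ->
    sb <= (singular_values (val (repr h)))`_0 -> ln (sb / sa) <= mu_gap 1 d h.
  move=> sa0 sb0 h1 h2; rewrite /mu_gap /sing_val /= ler_ln ?posrE ?divr_gt0 ?sv0//.
  by apply: ler_pM => //; rewrite ?invr_ge0 ?(ltW sa0) ?(ltW sb0)// lef_pV2 ?posrE ?sv0.
(* Singular values are numbered from 1, so the gap of index [d.-1] compares the entries [d.-2] and
   [d.-1] of the list. *)
split; apply: (NP m) => //.
- exact: (low _ _ (sv0 _ hd) (sv0 _ d0) top).
- apply: (gap_le _ _ (sv0 1%N hd) (sv0 0%N d0)) => //.
  by apply: sle; rewrite d1d andbT -ltnS prednK.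
- exact: (low _ _ (sv0 _ d1d) (sv0 _ d2d) bot).
- apply: (gap_le _ _ (sv0 _ d1d) (sv0 _ d2d)) => //.
  by apply: sle; rewrite d2d.
Qed.
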